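(* Let $A\in\mathbb{R}_{\max}^{d\times d}$ be irreducible with cyclicity $\gamma$ and factor rank $r$, and let $B$ be subordinate to $A$ such that $\lambda(B)\ne-\infty$. Let $\hat\sigma$ be the greatest cyclicity of the strongly connected components of $\mathcal{G}^c(A)$. Then the following bounds on $T_2(A,B)$ hold: $$T_2(A,B)\le\frac{\left(\gamma\,\mathrm{Wi}\left(\left\lfloor\frac{d}{\gamma}\right\rfloor\right)+d-1\right)\bigl(\lambda(A)-\min_{ij}a_{ij}\bigr)+\mathrm{cd}_B\bigl(\max_{ij}b_{ij}-\lambda(B)\bigr)}{\lambda(A)-\lambda(B)},$$ $$T_2(A,B)\le\frac{\left(\hat\sigma\left(\left\lfloor\frac{d}{\gamma}\right\rfloor-1\right)+d-1\right)\bigl(\lambda(A)-\min_{ij}a_{ij}\bigr)+\mathrm{cd}_B\bigl(\max_{ij}b_{ij}-\lambda(B)\bigr)}{\lambda(A)-\lambda(B)},$$ $$T_2(A,B)\le\frac{\left(\gamma\,\mathrm{Wi}\left(\left\lfloor\frac{r}{\gamma}\right\rfloor\right)+r+\gamma\right)\bigl(\lambda(A)-\min_{ij}a_{ij}\bigr)+\mathrm{cd}_B\bigl(\max_{ij}b_{ij}-\lambda(B)\bigr)}{\lambda(A)-\lambda(B)},$$ $$T_2(A,B)\le\frac{\left(\hat\sigma\left(\left\lfloor\frac{r}{\gamma}\right\rfloor-1\right)+r+\gamma\right)\bigl(\lambda(A)-\min_{ij}a_{ij}\bigr)+\mathrm{cd}_B\bigl(\max_{ij}b_{ij}-\lamb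da(B)\bigr)}{\lambda(A)-\lambda(B)}.$$
   Context: Max-plus algebra: $\mathbb{R}_{\max}=\mathbb{R}\cup\{-\infty\}$ with $a\oplus b=\max(a,b)$ and $a\otimes b=a+b$, extended to matrices by $(A\oplus B)_{ij}=a_{ij}\oplus b_{ij}$ and $(AB)_{ij}=(A\otimes B)_{ij}=\bigoplus_k a_{ik}\otimes b_{kj}$. $A^t$ is the $t$-th max-plus power, $A^0=I$ (entries $0$ on the diagonal, $-\infty$ elsewhere); $\lambda^{\otimes t}=t\lambda$ for a scalar, $\mu\otimes A$ adds $\mu$ to every entry, and matrix inequalities are entrywise. Factor rank: the (tropical) factor rank of $A\in\mathbb{R}_{\max}^{n\times m}$ is the smallest $r\in\mathbb{N}$ such that $A=U\otimes L$ for some $U\in\mathbb{R}_{\max}^{n\times r}$, $L\in\mathbb{R}_{\max}^{r\times m}$. Graphs: $\mathcal{G}(A)$ is the weighted digraph with nodes $1,\dots,d$ and an arc $(i,j)$ of weight $a_{ij}$ whenever $a_{ij}\ne-\infty$. Length is the number of arcs. A path is a walk with no repeated node. A cycle is a closed walk with at least one arc and no repeated node other than its coinciding ends. $A$ is irreducible if $\mathcal{G}(A)$ is strongly connected. $\lambda(A)$ is the maximum cycle mean (the maximum over all cycles of $\mathcal{G}(A)$ of weight divided by length, $-\infty$ if there is no cycle). The critical graph $\mathcal{G}^c(A)$ consists of all nodes and arcs of cycles with mean weight $\lambda(A)$; it is a disjoint union of strongly connected components with no arcs between them. The cyclicity of a strongly connected digraph is the gcd of the lengths of its cycles; the cyclicity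 of a disjoint union of strongly connected components is the lcm of their cyclicities. The cyclicity of $A$ is that of $\mathcal{G}(A)$. CSR terms: let $\sigma$ be the cyclicity of $\mathcal{G}^c(A)$ and $M=\left(((-\lambda(A))\otimes A)^{\sigma}\right)^*$, where $N^*=\bigoplus_{i\ge0}N^i$. Define $C,S,R$ by: $c_{ij}=m_{ij}$ if $j$ is a node of $\mathcal{G}^c(A)$ and $-\infty$ otherwise; $r_{ij}=m_{ij}$ if $i$ is a node of $\mathcal{G}^c(A)$ and $-\infty$ otherwise; $s_{ij}=a_{ij}-\lambda(A)$ if $(i,j)$ is an arc of $\mathcal{G}^c(A)$ and $-\infty$ otherwise. $B$ is subordinate to $A$ if $B$ is obtained from $A$ by setting some entries to $-\infty$ and keeping all other entries. $T_2(A,B)$ is the smallest integer $T$ such that $\lambda(A)^{\otimes t}\otimes CS^tR\ge B^t$ for all $t\ge T$. $\mathrm{cd}_B$ is the length of the longest path in $\mathcal{G}(B)$. $\min_{ij}a_{ij}$ is taken over the finite entries of $A$ and $\max_{ij}b_{ij}$ is the largest entry of $B$. $\mathrm{Wi}(n)=(n-1)^2+1$ if $n>1$ and $\mathrm{Wi}(1)=0$.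
   Formalization: The second and fourth bounds are proved with the right-hand side rounded up to an integer, since the integer T_2 can exceed the unrounded value (e.g. T_2=3 against 5/2); λ(A)≠λ(B) is assumed so that the quotients are defined. *)

(* Defs.v *)
From HB Require Import structures.
From mathcomp Require Import all_boot all_order all_algebra.
From mathcomp Require Import boolp classical_sets reals.

Set Implicit Arguments.
Unset Strict Implicit.
Unset Printing Implicit Defensive.

Import Order.TTheory GRing.Theory Num.Theory.
Local Open Scope ring_scope.

(** * The max-plus semiring

   [Rmax R] is R with -oo adjoined: [Some x] is the real number x and
   [ninf = None] is -oo.  It carries the semiring structure whose addition is
   max and whose multiplication is the addition of R.  Hence, at type [Rmax R],
     [0] is -oo,  [1] is the real number 0,  [\sum] is a maximum,
     [\prod] is a sum of reals,  [x ^+ t] is t times x,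
   and at type ['M[Rmax R]_(n, m)] the library operations [+], [*m], [^+] and
   [*:] are the max-plus sum, product, power and scaling of matrices. *)

Definition Rmax (R : realType) : Type := option R.

HB.instance Definition _ (R : realType) := Choice.on (Rmax R).

Definition ninf {R : realType} : Rmax R := None.

Section MaxPlus.
Variable R : realType.
Implicit Types x y z : Rmax R.

Definition rmax_add x y : Rmax R :=
  match x, y with
  | None, _ => y
  | _, None => x
  | Some a, Some b => Some (Num.max a b)
  end.

Definition rmax_mul x y : Rmax R :=
  match x, y with
  | Some a, Some b => Some (a + b)
  | _, _ => None
  end.

Definition rmax_one : Rmax R := Some 0.

Fact rmax_addA : associative rmax_add.
Proof. by move=> [a|] [b|] [c|] //=; rewrite maxA. Qed.

Fact rmax_addC : commutative rmax_add.
Proof. by move=> [a|] [b|] //=; rewrite maxC. Qed.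

Fact rmax_add0r : left_id ninf rmax_add.
Proof. by []. Qed.

Fact rmax_mulA : associative rmax_mul.
Proof. by move=> [a|] [b|] [c|] //=; rewrite addrA. Qed.

Fact rmax_mulC : commutative rmax_mul.
Proof. by move=> [a|] [b|] //=; rewrite addrC. Qed.

Fact rmax_mul1r : left_id rmax_one rmax_mul.
Proof. by move=> [a|] //=; rewrite add0r. Qed.

Fact rmax_mulDl : left_distributive rmax_mul rmax_add.
Proof. by move=> [a|] [b|] [c|] //=; rewrite addr_maxl. Qed.

Fact rmax_mul0r : left_zero ninf rmax_mul.
Proof. by []. Qed.

Fact rmax_one_neq0 : rmax_one != ninf.
Proof. by []. Qed.

End MaxPlus.

HB.instance Definition _ (R : realType) :=
  GRing.isNmodule.Build (Rmax R)
    (@rmax_addA R) (@rmax_addC R) (@rmax_add0r R).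
HB.instance Definition _ (R : realType) :=
  GRing.Nmodule_isComPzSemiRing.Build (Rmax R)
    (@rmax_mulA R) (@rmax_mulC R) (@rmax_mul1r R) (@rmax_mulDl R)
    (@rmax_mul0r R).
HB.instance Definition _ (R : realType) :=
  GRing.PzSemiRing_isNonZero.Build (Rmax R) (@rmax_one_neq0 R).

Definition rmax_le (R : realType) (x y : Rmax R) : bool :=
  match x, y with
  | None, _ => true
  | Some _, None => false
  | Some a, Some b => a <= b
  end.

(* The max-plus multiplicative inverse -x of a finite x; -oo is left fixed. *)
Definition rmax_inv (R : realType) (x : Rmax R) : Rmax R := omap -%R x.

(* The real number x, when x is finite; 0 is a junk value at -oo. *)
Definition fin_part (R : realType) (x : Rmax R) : R := odflt 0 x.

Definition mx_le (R : realType) (n m : nat) (A B : 'M[Rmax R]_(n, m)) : Prop :=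
  forall i j, rmax_le (A i j) (B i j).

Definition factors_through (R : realType) (n m : nat) (A : 'M[Rmax R]_(n, m))
    (r : nat) : Prop :=
  exists (U : 'M[Rmax R]_(n, r)) (L : 'M[Rmax R]_(r, m)), A = U *m L.

Definition is_factor_rank (R : realType) (n m : nat) (A : 'M[Rmax R]_(n, m))
    (r : nat) : Prop :=
  factors_through A r /\
  forall r', factors_through A r' -> (r <= r')%N.

(** * Digraphs on a finite type *)

Section Digraph.
Variable T : finType.
Implicit Types e : rel T.

Definition uniq_seqs : seq (seq T) :=
  [seq s <- flatten [seq [seq val t | t <- enum {: n.+1.-tuple T}]
                    | n <- iota 0 #|T|] | uniq s].

Lemma mem_uniq_seqs (s : seq T) : (s \in uniq_seqs) = (s != [::]) && uniq s.
Proof.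
rewrite mem_filter andbC; case us: (uniq s); last by rewrite !andbF.
rewrite !andbT; apply/flattenP/idP => [[ss /mapP[n _ ->] /mapP[t _ ->]]|].
  by rewrite -size_eq0 size_tuple.
case: s us => // x s us _.
exists [seq val t | t <- enum {: (size s).+1.-tuple T}].
  apply/mapP; exists (size s) => //.
  by rewrite mem_iota /= add0n -[X in (X <= _)%N](card_uniqP us) max_card.
by apply/mapP; exists (in_tuple (x :: s)) => //; rewrite mem_enum.
Qed.

(* A cycle x_1 -> x_2 -> ... -> x_k -> x_1 is listed as [:: x_1; ...; x_k],
   so its length is [size].  Each cycle occurs once per choice of x_1. *)
Definition simple_cycles e : seq (seq T) := [seq c <- uniq_seqs | cycle e c].

(* A path is listed by its nodes, so its length is [(size p).-1]. *)
Definition simple_paths e : seq (seq T) := [seq p <- uniq_seqs | sorted e p].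

Definition longest_path e : nat := \max_(p <- simple_paths e) (size p).-1.

Definition strongly_connected e : Prop := forall x y : T, connect e x y.

(* The cyclicity of the strongly connected component of x. *)
Definition scc_cyclicity e (x : T) : nat :=
  \big[gcdn/0%N]_(c <- simple_cycles e
                  | all (fun y => connect e x y && connect e y x) c) size c.

(* For the digraph with node set V and arc relation e (between nodes of V);
   the lcm and the max run over nodes instead of components, each component
   being counted once per node. *)
Definition cyclicity (V : pred T) e : nat :=
  \big[lcmn/1%N]_(x | V x) scc_cyclicity e x.

Definition max_scc_cyclicity (V : pred T) e : nat :=
  \max_(x | V x) scc_cyclicity e x.

End Digraph.

(** * Max-plus spectral notions and CSR terms *)

Section Matrices.
Variables (R : realType) (d : nat).
Implicit Types A B N : 'M[Rmax R]_d.

Definition has_arc A : rel 'I_d := fun i j => A i j != ninf.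

Definition irreducible A : Prop := strongly_connected (has_arc A).

Definition cycle_weight A (c : seq 'I_d) : Rmax R :=
  \prod_(x <- c) A x (next c x).

Definition cycle_mean A (c : seq 'I_d) : Rmax R :=
  omap (fun w : R => w / (size c)%:R) (cycle_weight A c).

Definition lambda A : Rmax R :=
  \sum_(c <- simple_cycles (has_arc A)) cycle_mean A c.

Definition critical_cycles A : seq (seq 'I_d) :=
  [seq c <- simple_cycles (has_arc A) | cycle_mean A c == lambda A].

Definition crit_node A : pred 'I_d :=
  fun i => has (fun c => i \in c) (critical_cycles A).

Definition crit_arc A : rel 'I_d :=
  fun i j => has (fun c => (i \in c) && (next c i == j)) (critical_cycles A).

Definition mx_cyclicity A : nat := cyclicity predT (has_arc A).

Definition crit_cyclicity A : nat := cyclicity (crit_node A) (crit_arc A).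

Definition max_crit_cyclicity A : nat :=
  max_scc_cyclicity (crit_node A) (crit_arc A).

(* Entrywise supremum of the powers of N.  [sup] has a junk value if the finite
   entries are unbounded above, which does not happen when lambda N <= 0. *)
Definition kleene_star N : 'M[Rmax R]_d :=
  \matrix_(i, j)
    if `[< exists k : nat, (N ^+ k) i j != ninf >]
    then Some (sup [set x : R | exists k : nat, (N ^+ k) i j = Some x])
    else ninf.

Definition csr_M A : 'M[Rmax R]_d :=
  kleene_star ((rmax_inv (lambda A) *: A) ^+ crit_cyclicity A).

Definition csr_C A : 'M[Rmax R]_d :=
  \matrix_(i, j) if crit_node A j then csr_M A i j else ninf.

Definition csr_R A : 'M[Rmax R]_d :=
  \matrix_(i, j) if crit_node A i then csr_M A i j else ninf.

Definition csr_S A : 'M[Rmax R]_d :=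
  \matrix_(i, j)
    if crit_arc A i j then A i j * rmax_inv (lambda A) else ninf.

Definition subordinate B A : Prop :=
  forall i j, B i j = A i j \/ B i j = ninf.

Definition csr_dominates_from A B (T : nat) : Prop :=
  forall t : nat, (T <= t)%N ->
    mx_le (B ^+ t) (lambda A ^+ t *: (csr_C A *m csr_S A ^+ t *m csr_R A)).

Definition is_T2 A B (T : nat) : Prop :=
  csr_dominates_from A B T /\
  forall T' : nat, csr_dominates_from A B T' -> (T <= T')%N.

Definition max_entry A : Rmax R := \sum_i \sum_j A i j.

(* The minimum over the finite entries; the initial value of the iteration is
   the largest entry, which is neutral as soon as A has a finite entry. *)
Definition min_fin_entry A : R :=
  \big[Num.min/fin_part (max_entry A)]_(p : 'I_d * 'I_d | has_arc A p.1 p.2)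
    fin_part (A p.1 p.2).

Definition T2_bound A B (K : R) : R :=
  (K * (fin_part (lambda A) - min_fin_entry A)
   + (longest_path (has_arc B))%:R
     * (fin_part (max_entry B) - fin_part (lambda B)))
  / (fin_part (lambda A) - fin_part (lambda B)).

End Matrices.

(* Wi 0 is a junk value. *)
Definition Wi (n : nat) : nat := if (1 < n)%N then ((n - 1) ^ 2 + 1)%N else 0%N.

(* Main.v *)
Require Import Defs.
From mathcomp Require Import all_boot all_order all_algebra.
From mathcomp Require Import boolp reals zify ring lra.

(** Normalise lambda(A) = 0 and fix one component G of the critical graph, of
   cyclicity g.  Inserting critical cycles shows that (C S^t R)_ij is at least
   the weight of every walk from i to j through G whose length is congruent to
   t modulo g.  So if the inequality fails at (t, i, j), a walk of length t in
   the graph of B realising (B^t)_ij avoids G, and its weight is at most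
   cd_B (max b - lambda(B)) + t lambda(B); it therefore suffices to find a short
   walk from i to j through G of the right length modulo g.

   Take such a walk of minimal length.  Two visits to a node at times congruent
   modulo g would allow a cut, so a node of G is visited at most h = g / gamma
   times; a node outside G is visited at most h + 1 times, by the same pigeonhole
   principle applied jointly before and after one visit to G.  The walk runs
   cyclically through the gamma cyclic classes, and counting its visits in the
   smallest class gives the bounds in d.  For a factorisation A = U L each arc
   x -> y is split as x -> p -> y through a label p, and the same count is made
   on labels; reaching a node of G rather than a label costs at most one more
   visit per class, hence the additional gamma.

   When the walk of B avoids G and is long, every cyclic class has an element
   outside G, so h is smaller than the smallest class; this turns the bounds in
   sigma into the Wielandt bounds, with room to spare. *)

Set Implicit Arguments.
Unset Strict Implicit.
Unset Printing Implicit Defensive.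

(** * Lengths of walks in a strongly connected component *)

Section Walks.
Variables (T : finType) (e : rel T).
Implicit Types (x y : T) (s c p : seq T).

(** Induct from the right: once the tail after x is simple, only x itself can recur, and the stretch
    up to its next visit is a simple cycle. *)
Lemma walk_loop x s : path e x s -> ~~ uniq (x :: s) ->
  exists s1 c s2, let y := last x s1 in
    [/\ s = s1 ++ rcons c y ++ s2, uniq (y :: c) & path e y (rcons c y)].
Proof.
elim: s x => [|y s IHs] x //= /andP[exy ps].
have [us|nus] := boolP (uniq (y :: s)); last first.
  have [s1 [c [s2 [def_s uc pc]]]] := IHs _ ps nus.
  by exists (y :: s1), c, s2; split=> //=; rewrite def_s.
move=> nuxs; have xs: x \in y :: s.
  by move: nuxs us => /=; case: (x \in _) => //= /negP.
have pys : path e x (y :: s) by rewrite /= exy.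
case/splitPr: xs us pys => p1 p2 us pys.
exists [::], p1, p2; split=> //=; first by rewrite cat_rcons.
  by move: us; rewrite cat_uniq /= => /and3P[-> /norP[-> _] _].
by move: pys; rewrite -cat_rcons cat_path => /andP[].
Qed.

Lemma mem_simple_cycles x c :
  (x :: c \in simple_cycles e) = uniq (x :: c) && path e x (rcons c x).
Proof. by rewrite mem_filter mem_uniq_seqs /= andbC. Qed.

Lemma walk_exists_connect x y : connect e x y ->
  exists2 s, path e x s & last x s = y.
Proof. by case/connectP=> s ps ->; exists s. Qed.

Lemma path_connect x s : path e x s -> connect e x (last x s).
Proof. by move=> ps; apply/connectP; exists s. Qed.

Hypothesis connect_symm : forall x y, connect e x y -> connect e y x.

Variable x0 : T.
Notation g := (scc_cyclicity e x0).

(** Cut out a simple cycle and recurse. Symmetry of connectivity keeps this cycle inside the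
    component of [x0], so its length is one of those whose gcd is [g]. *)
Lemma dvdn_closed_walk x s :
  connect e x0 x -> path e x s -> last x s = x -> g %| size s.
Proof.
move: {2}(size s).+1 (ltnSn (size s)) => n.
elim: n => // n IHn in x s *; rewrite ltnS => les cx ps ls.
case: s => [|y s] // in ps ls les *.
have xs : x \in y :: s by rewrite -{1}ls /= mem_last.
have nu : ~~ uniq (x :: y :: s) by rewrite cons_uniq xs.
have [s1 [c [s2 /= [def_s uc pc]]]] := walk_loop ps nu.
set z := last x s1 in def_s uc pc *.
have ps1 : path e x s1 by move: ps; rewrite def_s cat_path => /andP[].
have cz : connect e x0 z by apply: connect_trans cx (path_connect ps1).
have szc : g %| size (rcons c z).
  rewrite size_rcons -[(size c).+1]/(size (z :: c)).
  have inc : z :: c \in simple_cycles e by rewrite mem_simple_cycles /= uc.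
  rewrite /scc_cyclicity (perm_big _ (perm_to_rem inc)) big_cons.
  case: ifP => [_|/negP[]]; first exact: dvdn_gcdl.
  apply/allP=> v vc; suff xv: connect e x0 v by rewrite xv connect_symm.
  apply: connect_trans cz _; have: v \in rcons c z by rewrite mem_rcons.
  move: pc => /[swap] /splitPr[p1 p2]; rewrite -cat_rcons cat_path.
  by case/andP=> /path_connect; rewrite last_rcons.
rewrite -[_.+1]/(size (y :: s)) def_s !size_cat addnCA dvdn_addr // -size_cat; apply: (IHn x) => //.
- by apply: leq_trans les; rewrite def_s !size_cat size_rcons; lia.
- by move: ps; rewrite def_s !cat_path last_rcons => /and3P[-> _ ->].
- by rewrite -{2}ls def_s !last_cat last_rcons.
Qed.

Lemma connect_from_root x y : connect e x0 x -> connect e x0 y -> connect e x y.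
Proof. by move=> /connect_symm xx0; apply: connect_trans. Qed.

Section Modulus.
Variables (N : nat) (x : T).
Hypotheses (N_gt0 : N > 0) (cx : connect e x0 x).

Let closed_mod n :=
  exists s, [/\ path e x s, last x s = x & size s = n %[mod N]].

Let closed_mod_eq n m : n = m %[mod N] -> closed_mod n -> closed_mod m.
Proof. by move=> nm [s [? ? sz]]; exists s; split=> //; rewrite sz. Qed.

Let closed_modD n m : closed_mod n -> closed_mod m -> closed_mod (n + m).
Proof.
move=> [s [ps ls szs]] [s' [ps' ls' szs']]; exists (s ++ s').
by rewrite cat_path last_cat size_cat ls ps -modnDm szs szs' modnDm.
Qed.

Let closed_modM k n : closed_mod n -> closed_mod (k * n).
Proof.
move=> cn; elim: k => [|k IHk]; first by exists [::].
by rewrite mulSn; apply: closed_modD.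
Qed.

(* Modulo N, the subtraction in Bezout's identity is an addition of N - 1 copies. *)
Let closed_mod_gcd n m : closed_mod n -> closed_mod m -> closed_mod (gcdn n m).
Proof.
case: n => [|n] cn cm; first by rewrite gcd0n.
have [u v uv _] := egcdnP m (ltn0Sn n).
apply: (@closed_mod_eq (u * n.+1 + (N.-1 * v) * m)); last first.
  by apply: closed_modD; apply: closed_modM.
rewrite uv -mulnA addnAC -mulSn prednK //.
by rewrite mulnC modnMDl.
Qed.

(** Modulo [N], the lengths of closed walks at x are stable under sums and gcds, so it suffices to
    realise the length of each simple cycle of the component. *)
Lemma closed_walk_mod a :
  exists s, [/\ path e x s, last x s = x & size s = a * g %[mod N]].
Proof.
suff : closed_mod g by apply: closed_modM.
rewrite /scc_cyclicity big_seq_cond; elim/big_ind: _ => [||c].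
- by exists [::].
- exact: closed_mod_gcd.
case: c => [|z c]; first by rewrite mem_filter mem_uniq_seqs andbF.
rewrite mem_simple_cycles => /andP[/andP[_ pc] /= /andP[/andP[xz _] _]].
have [s1 ps1 ls1] := walk_exists_connect (connect_from_root cx xz).
have [s2 ps2 ls2] := walk_exists_connect (connect_from_root xz cx).
have c12 : closed_mod (size s1 + size s2).
  by exists (s1 ++ s2); rewrite cat_path last_cat size_cat ls1 ps1.
have c1c2 : closed_mod (size s1 + (size c).+1 + size s2).
  exists (s1 ++ rcons c z ++ s2).
  by rewrite !cat_path !last_cat !size_cat ls1 ps1 pc last_rcons ps2 size_rcons
     addnA.
(* The excursion to the cycle and back is cancelled modulo [N] by [N.-1] further copies of the
   excursion without the cycle. *)
apply: closed_mod_eq (closed_modD c1c2 (closed_modM N.-1 c12)).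
rewrite [_ + _ + size s2]addnAC [_ + (size c).+1]addnC -addnA -mulSn prednK //.
by rewrite mulnC addnC modnMDl.
Qed.

End Modulus.

Hypothesis g_gt0 : g > 0.

(** Take for [cls x] the length of a chosen walk from [x0] to x. Walks with the same ends agree in
    length modulo [g], because a common return walk closes both. *)
Lemma cyclic_classes : exists cls : T -> nat,
  [/\ cls x0 = 0 %[mod g],
      forall x s, connect e x0 x -> path e x s ->
        cls (last x s) = cls x + size s %[mod g]
    & forall x y N l, N > 0 -> connect e x0 x -> connect e x0 y ->
        cls y = cls x + l %[mod g] ->
        exists s, [/\ path e x s, last x s = y & size s = l %[mod N]]].
Proof.
have /choice[cls clsP] : forall x, exists n, connect e x0 x ->
    exists s, [/\ path e x0 s, last x0 s = x & size s = n].
  move=> x; have [cx|ncx] := boolP (connect e x0 x); last by exists 0.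
  by have [s ps ls] := walk_exists_connect cx; exists (size s), s.
have clsD x s : connect e x0 x -> path e x s ->
    cls (last x s) = cls x + size s %[mod g].
  move=> cx ps; have [s1 [p1 l1 <-]] := clsP _ cx.
  have cy : connect e x0 (last x s) := connect_trans cx (path_connect ps).
  have [s2 [p2 l2 <-]] := clsP _ cy.
  have [s3 p3 l3] := walk_exists_connect (connect_symm cy).
  have d2 : g %| size (s2 ++ s3).
    apply: (@dvdn_closed_walk x0) => //; first by rewrite cat_path p2 l2.
    by rewrite last_cat l2.
  have d1 : g %| size (s1 ++ s ++ s3).
    apply: (@dvdn_closed_walk x0) => //; first by rewrite !cat_path p1 l1 ps.
    by rewrite !last_cat l1.
  move: d1 d2; rewrite !size_cat addnA => d1 d2.
  apply/eqP; rewrite -(eqn_modDr (size s3)).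
  by move: d1 d2; rewrite /dvdn => /eqP -> /eqP ->.
exists cls; split=> // [|x y N l N0 cx cy cxy].
  have [s [ps ls <-]] := clsP _ (connect0 e x0); rewrite mod0n.
  by apply/eqP; apply: dvdn_closed_walk (connect0 e x0) ps ls.
have [s ps ls] := walk_exists_connect (connect_from_root cx cy).
have sz : size s = l %[mod g].
  by apply/eqP; rewrite -(eqn_modDl (cls x)) -clsD // ls cxy.
(* This number is l - size s modulo [N * g], hence modulo [N] and modulo [g]; a closed walk of that
   length modulo [N] is put in front of s. *)
have : g %| l + (N * g).-1 * size s.
  rewrite /dvdn -modnDml -sz modnDml -mulSn prednK ?muln_gt0 ?N0 //.
  by rewrite mulnAC modnMl.
case/dvdnP=> a def_a.
have [s1 [p1 l1 z1]] := closed_walk_mod N0 cx a.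
exists (s1 ++ s); split; rewrite ?cat_path ?last_cat ?l1 ?p1 //.
rewrite size_cat -modnDml z1 modnDml -def_a -addnA -mulSnr prednK; last first.
  by rewrite muln_gt0 N0.
by rewrite -mulnA addnC mulnC modnMDl.
Qed.

End Walks.

(** * Walks and cyclic classes *)

Lemma sum_count_mem (T : finType) (P : pred T) (s : seq T) :
  \sum_(p | P p) count_mem p s = count P s.
Proof.
rewrite -sum1_count [RHS](partition_big id P) //=.
apply: eq_bigr => p Pp; rewrite -sum1_count; apply: eq_bigl => q.
by apply/eqP/andP=> [->|[_ /eqP]].
Qed.

(** Residues in one class modulo [gamma] are told apart by their quotient by [gamma], which is below
    h. Every bound on visits rests on this pigeonhole. *)
Lemma size_residues gamma h c (L : seq nat) : gamma > 0 -> uniq L ->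
  (forall v, v \in L -> v < gamma * h /\ v %% gamma = c) -> size L <= h.
Proof.
move=> gamma0 uL inL; rewrite -(size_iota 0 h) -(size_map (divn^~ gamma) L).
apply: uniq_leq_size => [|_ /mapP[v /inL[vlt _] ->]]; last first.
  by rewrite mem_iota /= ltn_divLR // mulnC.
rewrite map_inj_in_uniq // => v w /inL[_ vc] /inL[_ wc] vw.
by rewrite (divn_eq v gamma) (divn_eq w gamma) vw vc wc.
Qed.

(** * Replacing a stretch of a walk *)

Section Splice.
Variables (T : finType) (e : rel T) (x0 : T).
Implicit Types s m : seq T.

(** Both end positions k and k' are dropped as well, so m has to supply the end nodes; a cut between
    two visits to a node is the case where m is that node alone. *)
Definition splice s k k' m := take k s ++ m ++ drop k'.+1 s.

Lemma size_splice s k k' m : k <= k' -> k' < size s ->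
  size (splice s k k' m) = size m + (size s - (k' - k).+1).
Proof.
move=> kk' k's; rewrite !size_cat size_drop size_takel; first by lia.
by apply: leq_trans kk' (ltnW k's).
Qed.

Lemma size_splice1 s k k' a : k <= k' -> k' < size s ->
  size (splice s k k' [:: a]) = size s - (k' - k).
Proof.
move=> kk' k's; rewrite size_splice // add1n subnSK //.
exact: leq_ltn_trans (leq_subr _ _) k's.
Qed.

Lemma mem_splice s k k' m b : b < size s -> (b < k) || (k' < b) ->
  nth x0 s b \in splice s k k' m.
Proof.
rewrite !mem_cat => bs /orP[bk|kb].
  by rewrite -(nth_take x0 bk) mem_nth // size_take_min leq_min bk.
by rewrite -(subnKC kb) -nth_drop mem_nth ?orbT // size_drop ltn_sub2r // (leq_ltn_trans kb).
Qed.

Section Replace.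
Variables (s m : seq T) (k k' : nat) (a : T).
Hypotheses (kk' : k <= k') (k's : k' < size s).
Hypotheses (hm : a = nth x0 s k) (lm : last a m = nth x0 s k').

Lemma splice_sorted : sorted e s -> path e a m ->
  sorted e (splice s k k' (a :: m)).
Proof.
move=> ss pm; have ks := leq_ltn_trans kk' k's.
rewrite /splice sorted_cat_cons hm -take_nth // (take_sorted _ ss) /=.
rewrite cat_path -hm pm lm.
by have := drop_sorted k' ss; rewrite (drop_nth x0).
Qed.

Lemma splice_head : head x0 (splice s k k' (a :: m)) = head x0 s.
Proof.
have ks := leq_ltn_trans kk' k's; rewrite /splice.
case: k hm ks => [|n] -> ks; first by rewrite take0 /= nth0.
by case: s ks.
Qed.

Lemma splice_last : last x0 (splice s k k' (a :: m)) = last x0 s.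
Proof.
rewrite /splice last_cat /= last_cat lm -[in RHS](cat_take_drop k' s).
by rewrite (drop_nth x0 k's) last_cat.
Qed.

End Replace.
End Splice.

Section Classes.
Variables (T : finType) (e : rel T) (gamma : nat) (gcl : T -> nat) (x0 : T).
Hypothesis gamma_gt0 : gamma > 0.
Hypothesis gclS : forall p q, e p q -> gcl q = gcl p + 1 %[mod gamma].
Implicit Types s m : seq T.

Lemma gcl_nth s k k' : sorted e s -> k <= k' -> k' < size s ->
  gcl (nth x0 s k') = gcl (nth x0 s k) + (k' - k) %[mod gamma].
Proof.
move=> ss; elim: k' => [|k' IH] kk' k's.
  by move: kk'; rewrite leqn0 => /eqP ->; rewrite addn0.
move: kk'; rewrite leq_eqVlt => /orP[/eqP->|kk']; first by rewrite subnn addn0.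
have step : e (nth x0 s k') (nth x0 s k'.+1) by apply: (sortedP x0 ss).
by rewrite (gclS step) -modnDml IH ?(ltnW k's) // modnDml subSn // -addnA addn1.
Qed.

Lemma gcl_eq_nth s k k' : sorted e s -> k < size s -> k' < size s ->
  gcl (nth x0 s k) + k' = gcl (nth x0 s k') + k %[mod gamma].
Proof.
move=> ss; wlog kk' : k k' / k <= k'.
  by move=> H; case/orP: (leq_total k k') => kk' *; [|symmetry]; apply: H.
move=> ks k's; rewrite -[in RHS]modnDml (gcl_nth ss kk' k's) modnDml.
by rewrite -addnA subnK.
Qed.

Definition class_count c s := count (fun p => gcl p %% gamma == c) s.

Lemma class_countE c s :
  class_count c s = count_mem c [seq gcl p %% gamma | p <- s].
Proof. by rewrite count_map. Qed.

Lemma uniq_classes s : sorted e s -> size s <= gamma ->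
  uniq [seq gcl p %% gamma | p <- s].
Proof.
move=> ss szs; apply/(uniqP 0) => i j; rewrite !inE size_map.
wlog ij : i j / i <= j.
  move=> H; case/orP: (leq_total i j) => ij ii jj eij; first exact: H.
  by symmetry; apply: H.
move=> is_ js; rewrite !(nth_map x0) // (gcl_nth ss ij js) => /eqP.
rewrite -[X in X %% _ == _]addn0 eqn_modDl mod0n modn_small; first by lia.
by apply: leq_ltn_trans (leq_subr _ _) (leq_trans js szs).
Qed.

Lemma mem_classes s c : sorted e s -> gamma <= size s -> c < gamma ->
  exists2 p, p \in s & gcl p %% gamma = c.
Proof.
move=> ss szs cg; have sts : sorted e (take gamma s) := take_sorted _ ss.
have sz : size (take gamma s) = gamma by rewrite size_takel.
have usub : {subset [seq gcl p %% gamma | p <- take gamma s] <= iota 0 gamma}.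
  by move=> _ /mapP[p _ ->]; rewrite mem_iota ltn_mod.
have us := uniq_classes sts (eq_leq sz).
have [|_ eqi] := uniq_min_size us usub; first by rewrite size_map size_iota sz.
have : c \in iota 0 gamma by rewrite mem_iota.
by rewrite -eqi => /mapP[p /mem_take ps ->]; exists p.
Qed.

(** Each block of [gamma] consecutive nodes meets every class exactly once, and the incomplete last
    block meets each class at most once. *)
Lemma class_count_balanced s c c' : sorted e s -> c < gamma -> c' < gamma ->
  class_count c s <= (class_count c' s).+1.
Proof.
move: {2}(size s).+1 (ltnSn (size s)) => n.
elim: n => // n IHn in s *; rewrite ltnS => szs ss cg c'g.
have small u : sorted e u -> size u <= gamma -> class_count c u <= 1.
  by move=> su zu; rewrite class_countE count_uniq_mem ?uniq_classes ?leq_b1.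
have [lt|ge] := ltnP (size s) gamma.
  by apply: leq_trans (small _ ss (ltnW lt)) _.
have sz : size (take gamma s) = gamma by rewrite size_takel.
rewrite -(cat_take_drop gamma s) /class_count !count_cat -addnS leq_add //.
  have st := take_sorted gamma ss.
  apply: leq_trans (small _ st (eq_leq sz)) _; rewrite -has_count.
  have [p ps pc] := mem_classes st (eq_leq (esym sz)) c'g.
  by apply/hasP; exists p => //; apply/eqP.
apply: IHn => //; last exact: drop_sorted.
rewrite size_drop; lia.
Qed.

Let class (p : T) : 'I_gamma := Ordinal (ltn_pmod (gcl p) gamma_gt0).

Lemma sum_class_count s : \sum_(c < gamma) class_count c s = size s.
Proof.
rewrite -sum1_size (partition_big class predT) //=; apply: eq_bigr => c _.
by rewrite /class_count -sum1_count; apply: eq_bigl => q.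
Qed.

Definition class_card c := #|[pred p | gcl p %% gamma == c]|.

Lemma sum_class_card : \sum_(c < gamma) class_card c = #|T|.
Proof.
rewrite -sum1_card (partition_big class predT) //=; apply: eq_bigr => c _.
by rewrite /class_card -sum1_card; apply: eq_bigl => q.
Qed.

Lemma leq_class_card k : (forall c, c < gamma -> k <= class_card c) ->
  k <= #|T| %/ gamma.
Proof.
move=> kc; rewrite leq_divRL // -sum_class_card.
rewrite mulnC -[X in X * _]card_ord -sum_nat_const; apply: leq_sum => c _.
exact: kc.
Qed.

(** The factor of h should be the size n of the smallest class, not that of c. A class with at most
    n elements satisfies this by its own bound. A larger class receives at most one visit more than
    the smallest one, and its additional elements pay for that visit. *)
Lemma size_of_class_counts h (eps : bool) s : sorted e s ->
  (forall c, c < gamma ->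
     class_count c s + h <= class_card c * h + class_card c + eps) ->
  size s + gamma * h <= gamma * h * (#|T| %/ gamma) + #|T| + gamma * eps.
Proof.
move=> ss bound; pose c0 := [arg min_(c < Ordinal gamma_gt0) class_card c].
have c0min c : class_card c0 <= class_card (c : 'I_gamma).
  by rewrite /c0; case: arg_minnP => // i _; apply.
have c0n : class_card c0 <= #|T| %/ gamma.
  apply: leq_class_card => c cg; exact: (c0min (Ordinal cg)).
move: (#|T| %/ gamma) c0n => n c0n.
have boundn (c : 'I_gamma) :
    class_count c s + h <= h * n + class_card c + eps.
  have := bound c (ltn_ord c).
  have [cn|nc] := leqP (class_card c) n; first by nia.
  have := class_count_balanced ss (ltn_ord c) (ltn_ord c0).
  have := bound c0 (ltn_ord c0); nia.
have : \sum_(c < gamma) (class_count c s + h) <=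
       \sum_(c < gamma) (h * n + class_card c + eps).
  by apply: leq_sum => c _; apply: boundn.
rewrite !big_split /= !sum_nat_const !card_ord sum_class_count sum_class_card.
by rewrite mulnA.
Qed.

End Classes.

(** * Short walks with a prescribed length modulo the cyclicity *)

Section ShortWalks.
Variables (T : finType) (e : rel T) (gamma h : nat) (gcl cls : T -> nat).
Variables (G : pred T) (x0 : T).
Hypotheses (gamma_gt0 : gamma > 0) (h_gt0 : h > 0).
Hypothesis gclS : forall p q, e p q -> gcl q = gcl p + 1 %[mod gamma].
Notation g := (gamma * h).
Hypothesis cls_gcl : forall p, G p -> cls p = gcl p %[mod gamma].
Hypothesis cls_onto : forall a, exists2 p, G p & cls p = a %[mod g].
Variables (I J : pred T) (t : nat).
Implicit Types s m : seq T.

(** The ends are given by predicates because the end labels of a walk of labels are only constrained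
    through [U] and [L]. Since [size] counts entries, t is the length plus one for walks of nodes,
    and the length itself for walks of labels, where an entry stands for an arc. *)
Definition touching s :=
  [/\ size s > 0, sorted e s, I (head x0 s) && J (last x0 s),
      size s = t %[mod g] & has G s].

Let g_gt0 : g > 0. Proof. by rewrite muln_gt0 gamma_gt0. Qed.

Let dvd_gamma_g : gamma %| g. Proof. exact: dvdn_mulr. Qed.

Let modg a b : a = b %[mod g] -> a = b %[mod gamma].
Proof. by move=> ab; rewrite -(modn_dvdm a dvd_gamma_g) ab modn_dvdm. Qed.

Let gcard c := #|[pred p | G p && (gcl p %% gamma == c)]|.

(** Every residue modulo [g] is the class of an element of [G], and h of these residues reduce to c
    modulo [gamma]. *)
Lemma leq_critical_card c : c < gamma -> h <= gcard c.
Proof.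
move=> cg.
have /choice[f fP] : forall a : 'I_h, exists p, G p /\ cls p = c + gamma * a %[mod g].
  by move=> a; have [p Gp cp] := cls_onto (c + gamma * a); exists p.
rewrite -[h]card_ord -(@card_codom _ _ f); last first.
  move=> a b eab; have [_ ca] := fP a; have [_ cb] := fP b.
  have small (u : 'I_h) : c + gamma * u < g.
    by have := ltn_ord u; nia.
  move: ca; rewrite eab cb !(modn_small (small _)) => /addnI /eqP.
  by rewrite eqn_pmul2l // => /eqP ba; exact/esym/val_inj.
apply: subset_leq_card; apply/subsetP=> _ /codomP[a ->].
have [Ga ca] := fP a; rewrite inE Ga -cls_gcl // (modg ca) /=.
by rewrite [gamma * a]mulnC addnC modnMDl modn_small.
Qed.

Lemma leq_cyclicity_card : h <= #|T| %/ gamma.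
Proof.
apply: (@leq_class_card T gamma gcl) => // c cg.
apply: leq_trans (leq_critical_card cg) (subset_leq_card _).
by apply/subsetP=> p; rewrite !inE => /andP[].
Qed.

Lemma ltn_cyclicity_card s :
  sorted e s -> gamma <= size s -> ~~ has G s -> h < #|T| %/ gamma.
Proof.
move=> ss szs nG; apply: (@leq_class_card T gamma gcl) => // c cg.
have [p ps pc] := mem_classes x0 gamma_gt0 gclS ss szs cg.
rewrite /class_card (cardD1 p) inE pc eqxx ltnS.
apply: leq_trans (leq_critical_card cg) (subset_leq_card _).
apply/subsetP=> q; rewrite !inE => /andP[Gq ->]; rewrite andbT.
by apply: contraNneq nG => qp; apply/hasP; exists p => //; rewrite -qp.
Qed.

(** Allowing h + 1 visits to every element overcounts the elements of [G] by one each, and every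
    class has at least h of them: this yields the gain of h per class, hence of [g] in total. The
    flag grants x one more visit. *)
Lemma size_of_counts s (eps : bool) x : sorted e s ->
  (forall p, count_mem p s <= h + ~~ G p + (eps && (p == x))) ->
  size s + g <= g * (#|T| %/ gamma) + #|T| + gamma * eps.
Proof.
move=> ss cs; apply: (size_of_class_counts x0 gamma_gt0 gclS) => // c cg.
rewrite /class_count -sum_count_mem.
have sum_bool (b : pred T) :
    \sum_(p | gcl p %% gamma == c) (b p : nat) =
    #|[pred p | b p && (gcl p %% gamma == c)]|.
  rewrite -sum1_card [RHS](eq_bigl (fun p => (gcl p %% gamma == c) && b p)).
    by rewrite [RHS]big_mkcondr; apply: eq_bigr => p _; case: (b p).
  by move=> p; rewrite inE andbC.
have : \sum_(p | gcl p %% gamma == c) count_mem p s <=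
       \sum_(p | gcl p %% gamma == c) (h + ~~ G p + (eps && (p == x))).
  by apply: leq_sum => p _; apply: cs.
rewrite !big_split /= sum_nat_const !sum_bool -/(class_card gamma gcl c).
have Gc := leq_critical_card cg.
have cardG : #|[pred p | ~~ G p && (gcl p %% gamma == c)]| + gcard c =
    class_card gamma gcl c.
  rewrite /class_card -(cardID G [pred p | gcl p %% gamma == c]) addnC.
  congr (_ + _); apply: eq_card => p; by rewrite !inE andbC.
have card_eps : #|[pred p | (eps && (p == x)) && (gcl p %% gamma == c)]| <= eps.
  case: eps {cs} => /=; last by rewrite leqn0; apply/eqP/eq_card0.
  by rewrite -(card1 x); apply/subset_leq_card/subsetP=> p; rewrite !inE => /andP[].
move=> sumN; apply: leq_trans (leq_add sumN Gc) _.
by rewrite addnAC leq_add // -addnA cardG.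
Qed.

(** * Visit counts of a shortest walk through G *)

Section Minimal.
Variable s : seq T.
Hypothesis touch_s : touching s.
Hypothesis min_s : forall s', touching s' -> size s <= size s'.

Let s_sorted : sorted e s. Proof. by case: touch_s. Qed.


Lemma touching_splice u k k' a m : touching u -> k <= k' -> k' < size u ->
  a = nth x0 u k -> last a m = nth x0 u k' -> path e a m ->
  k' = k + size m %[mod g] -> has G (splice u k k' (a :: m)) ->
  touching (splice u k k' (a :: m)).
Proof.
move=> [u0 su IJ szu _] kk' k'u hm lm pm km hG.
have sz := size_splice (a :: m) kk' k'u; split => //.
- by rewrite sz addn_gt0.
- exact: (splice_sorted kk' k'u hm lm).
- by rewrite (splice_head _ kk' k'u hm) (splice_last _ k'u lm).
rewrite sz /= -szu; apply/eqP; rewrite -(eqn_modDr (k' - k)).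
have -> : (size m).+1 + (size u - (k' - k).+1) + (k' - k) = size u + size m.
  by move: kk' k'u; clear; lia.
rewrite eqn_modDl -(eqn_modDl k) subnKC //; apply/eqP.
by rewrite km.
Qed.

Lemma touching_cut u k k' : touching u -> k < k' -> k' < size u ->
  nth x0 u k = nth x0 u k' -> k = k' %[mod g] ->
  has G (splice u k k' [:: nth x0 u k]) ->
  touching (splice u k k' [:: nth x0 u k]) /\
  size (splice u k k' [:: nth x0 u k]) < size u.
Proof.
move=> tu kk' k'u ukk' km hG; have kk := ltnW kk'; split.
  by apply: touching_splice => //; rewrite addn0.
by rewrite size_splice1 //; clear km; lia.
Qed.

Section Cut.
Variable b : nat.
Hypotheses (bs : b < size s) (Gb : G (nth x0 s b)).

Lemma no_single_cut k k' : k < k' -> k' < size s -> nth x0 s k = nth x0 s k' ->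
  k = k' %[mod g] -> (b <= k) || (k' <= b) -> False.
Proof.
move=> kk' k's skk' km bk.
have [|tu lt] := touching_cut touch_s kk' k's skk' km.
  apply/hasP; exists (nth x0 s b) => //.
  have [->|nk] := eqVneq b k; first by rewrite mem_cat mem_head orbT.
  have [->|nk'] := eqVneq b k'; first by rewrite -skk' mem_cat mem_head orbT.
  by apply: mem_splice => //; lia.
by have := min_s tu; rewrite leqNgt lt.
Qed.

(** Neither cut alone need respect the length modulo [g], but together they remove a multiple of
    [g], and position b survives between them. *)
Lemma no_double_cut k k' l l' : k <= k' -> k' <= b -> b < l -> l <= l' ->
  l' < size s -> nth x0 s k = nth x0 s k' -> nth x0 s l = nth x0 s l' ->
  k + l = k' + l' %[mod g] -> (k < k') || (l < l') -> False.
Proof.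
move=> kk' k'b bl ll' l's sk sl km lt.
(* The later stretch is cut first, so that positions up to l keep their indices. *)
pose m := [:: nth x0 s l]; set u := splice s l l' m.
have szu : size u = size s - (l' - l) by rewrite size_splice1.
have nthu j : j <= l -> nth x0 u j = nth x0 s j.
  move=> jl; rewrite nth_cat size_takel; last by lia.
  move: jl; rewrite leq_eqVlt => /orP[/eqP->|jl]; first by rewrite ltnn subnn.
  by rewrite jl nth_take.
have su : sorted e u by apply: splice_sorted => //=.
have ku : k' < size u by rewrite szu; lia.
have sk' : nth x0 u k = nth x0 u k' by rewrite !nthu //; lia.
set v := splice u k k' [:: nth x0 u k].
have szv : size v = size u - (k' - k) by rewrite size_splice1.
suff tv : touching v.
  by have := min_s tv; rewrite szv szu; clear km; lia.
case: touch_s => s0 _ IJ szs _; split.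
- by rewrite szv subn_gt0 (leq_ltn_trans (leq_subr _ _)).
- by apply: splice_sorted.
- by rewrite (splice_head _ kk' ku) // (splice_last _ ku) //
     (splice_head _ ll' l's) // (splice_last _ l's).
- rewrite -szs szv szu; apply/eqP.
  rewrite -(eqn_modDr (k' + l')).
  have -> : size s - (l' - l) - (k' - k) + (k' + l') = size s + (k + l).
    by move: kk' k'b bl ll' l's; clear; lia.
  by rewrite eqn_modDl; apply/eqP.
apply/hasP; exists (nth x0 s b) => //; rewrite -nthu ?(ltnW bl) //.
have [->|nk'] := eqVneq b k'; first by rewrite -sk' mem_cat mem_head orbT.
by apply: mem_splice; move: ll' l's bl nk' k'b; rewrite ?szu; clear; lia.
Qed.


End Cut.

Let positions p r := [seq k <- r | nth x0 s k == p].

Let mem_positions p r k :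
  (k \in positions p r) = (nth x0 s k == p) && (k \in r).
Proof. by rewrite mem_filter. Qed.

Let size_positions p i j : j <= size s - i ->
  count_mem p (take j (drop i s)) = size (positions p (iota i j)).
Proof. by move=> ij; rewrite -(map_nth_iota x0) // count_map size_filter. Qed.

(** This confines the visits to one node to h residues modulo [g]. *)
Let position_class k k' : k < size s -> k' < size s ->
  nth x0 s k = nth x0 s k' -> k = k' %[mod gamma].
Proof.
move=> ks k's kk'; apply/eqP; rewrite eq_sym.
rewrite -(eqn_modDl (gcl (nth x0 s k))) {2}kk'.
by apply/eqP; apply: (gcl_eq_nth x0 gclS).
Qed.

Let size_distinct_residues (L : seq nat) (F : nat -> nat) (c : nat) :
  uniq L -> {in L &, forall k k', F k = F k' %[mod g] -> k = k'} ->
  {in L, forall k, F k %% gamma = c} -> size L <= h.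
Proof.
move=> uL injF Fc; rewrite -(size_map (fun k => F k %% g)).
apply: (size_residues (c := c) gamma_gt0).
  by rewrite map_inj_in_uniq.
by move=> _ /mapP[k kp ->]; rewrite ltn_mod g_gt0 modn_dvdm // Fc.
Qed.

Let count_mem_positions p :
  count_mem p s = size (positions p (iota 0 (size s))).
Proof.
by rewrite -size_positions ?subn0 // drop0 take_size.
Qed.

Let positions_lt p k : k \in positions p (iota 0 (size s)) -> k < size s.
Proof. by rewrite mem_positions mem_iota => /andP[]. Qed.

Let positions_nth p r k : k \in positions p r -> nth x0 s k = p.
Proof. by rewrite mem_positions => /andP[/eqP]. Qed.

Let critical_position_inj k k' : k < size s -> k' < size s ->
  G (nth x0 s k) -> nth x0 s k = nth x0 s k' -> k = k' %[mod g] -> k = k'.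
Proof.
move=> ks k's Gk kk' km; case: (ltngtP k k') => // lt.
  by case: (no_single_cut ks Gk lt k's kk' km); rewrite leqnn.
rewrite kk' in Gk.
by case: (no_single_cut k's Gk lt ks (esym kk') (esym km)); rewrite leqnn.
Qed.

(** A visit to p can itself serve as the preserved visit to [G], so two visits congruent modulo [g]
    would always allow a cut. *)
Lemma count_critical p : G p -> count_mem p s <= h.
Proof.
move=> Gp; have [ps|nps] := boolP (p \in s); last by rewrite (count_memPn nps).
rewrite count_mem_positions.
apply: (size_distinct_residues (F := id) (c := index p s %% gamma)).
- by rewrite filter_uniq ?iota_uniq.
- move=> k k' kp k'p; have sk := positions_nth kp; have sk' := positions_nth k'p.
  by apply: critical_position_inj; rewrite ?sk ?sk' // (positions_lt kp, positions_lt k'p).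
- move=> k kp; apply: position_class; rewrite ?index_mem ?nth_index //.
    exact: positions_lt kp.
  exact: positions_nth kp.
Qed.

(* With k, k' visits to p up to a fixed visit b to G and l, l' visits to p after
   b, cutting both [k, k'] and [l, l'] is impossible if k + l = k' + l' mod g.
   Taking for k' the last visit before b and for l the first one after b, the
   sums k + l and k' + l' are distinct residues in one class modulo gamma. *)
Lemma count_noncritical p : count_mem p s <= h.+1.
Proof.
have [_ _ _ _ /hasP[x xs Gx]] := touch_s.
pose b := index x s.
have bs : b < size s by rewrite index_mem.
have Gb : G (nth x0 s b) by rewrite nth_index.
pose P := positions p (iota 0 (size s)).
pose P1 := [seq k <- P | k <= b]; pose P2 := [seq k <- P | ~~ (k <= b)].
have szP : count_mem p s = size P1 + size P2.
  by rewrite count_mem_positions -/P -(count_predC (fun k => k <= b)) -!size_filter.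
have uP : uniq P := filter_uniq _ (iota_uniq _ _).
have uP1 : uniq P1 := filter_uniq _ uP.
have uP2 : uniq P2 := filter_uniq _ uP.
have inP k : k \in P -> k < size s /\ nth x0 s k = p.
  by move=> kP; split; [apply: positions_lt kP | apply: positions_nth kP].
have inP1 k : k \in P1 -> [/\ k < size s, nth x0 s k = p & k <= b].
  by rewrite mem_filter => /andP[kb /inP[]].
have inP2 k : k \in P2 -> [/\ k < size s, nth x0 s k = p & b < k].
  by rewrite mem_filter -ltnNge => /andP[kb /inP[]].
have P_inj k k' : k \in P -> k' \in P -> (k <= b) = (k' <= b) ->
    k = k' %[mod g] -> k = k'.
  wlog lt : k k' / k < k'.
    move=> H kP k'P; case: (ltngtP k k') => // lt kb km; first exact: H.
    by symmetry; apply: H.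
  move=> /inP[ks sk] /inP[k's sk'] kb km.
  case: (no_single_cut bs Gb lt k's _ km); first by rewrite sk sk'.
  by rewrite -kb; case: (leqP k b) => [_|/ltnW ->]; rewrite ?orbT.
have P_class k k' : k \in P -> k' \in P -> k = k' %[mod gamma].
  move=> /inP[ks sk] /inP[k's sk']; apply: position_class => //.
  by rewrite sk sk'.
have subP1 : {subset P1 <= P} by move=> k; rewrite mem_filter => /andP[].
have subP2 : {subset P2 <= P} by move=> k; rewrite mem_filter => /andP[].
have one_side L : uniq L -> {subset L <= P} ->
    {in L &, forall k k', (k <= b) = (k' <= b)} -> size L <= h.
  case: L => // k0 L uL LP Lb.
  apply: (size_distinct_residues (F := id) (c := k0 %% gamma)) => //.
    by move=> k k' kL k'L; apply: P_inj; rewrite ?LP ?(Lb k k').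
  by move=> k kL; apply: P_class; apply: LP; rewrite ?mem_head.
have [P1_0|P1_n0] := posnP (size P1).
  rewrite szP P1_0 add0n leqW // one_side // => k k' /inP2[_ _ kb] /inP2[_ _ k'b].
  by rewrite leqNgt kb leqNgt k'b.
have [P2_0|P2_n0] := posnP (size P2).
  rewrite szP P2_0 addn0 leqW // one_side // => k k' /inP1[_ _ ->].
  by case/inP1 => _ _ ->.
have exP1 : exists k, k \in P1 by exists (nth 0 P1 0); apply: mem_nth.
have exP2 : exists k, k \in P2 by exists (nth 0 P2 0); apply: mem_nth.
have bP1 k : k \in P1 -> k <= size s by case/inP1 => /ltnW.
case: (ex_maxnP exP1 bP1) => a aP1 a_max.
case: (ex_minnP exP2) => q qP2 q_min.
have szL : size (P1 ++ rem q P2) = (size P1 + size P2).-1.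
  by rewrite size_cat size_rem // -subn1 addnBA // subn1.
suff : size (P1 ++ rem q P2) <= h by rewrite szP szL; clear -P1_n0; lia.
(* [F] lists the sums k + q for visits up to b and a + l for visits after b. The sum a + q arises
   from both sides, so q is removed; this is the one visit beyond h. *)
pose F k := if k <= b then k + q else a + k.
have inrem l : l \in rem q P2 -> q < l /\ l \in P2.
  by rewrite mem_rem_uniq // !inE => /andP[lq lP2]; rewrite ltn_neqAle eq_sym lq q_min.
apply: (size_distinct_residues (F := F) (c := (a + q) %% gamma)).
- rewrite cat_uniq uP1 rem_uniq // andbT /=; apply/hasPn => l /inrem[_ /inP2[_ _]].
  by rewrite ltnNge; apply: contra => /inP1[].
- have cross k l : k \in P1 -> l \in rem q P2 -> F k = F l %[mod g] -> False.
    move=> kP1 /inrem[ql lP2].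
    have [_ sq bq] := inP2 _ qP2; have [ls sl bl] := inP2 _ lP2.
    have [_ sa ab] := inP1 _ aP1; have [ks sk kb] := inP1 _ kP1.
    rewrite /F kb leqNgt bl /= => km.
    apply: (no_double_cut bs Gb (a_max _ kP1) ab bq (ltnW ql) ls) => //.
    + by rewrite sk sa.
    + by rewrite sq sl.
    + by rewrite ql orbT.
  move=> k k'; rewrite !mem_cat => /orP[kP1|kP2] /orP[k'P1|k'P2].
  + have [[_ _ kb] [_ _ k'b]] := (inP1 _ kP1, inP1 _ k'P1).
    rewrite /F kb k'b => /eqP; rewrite eqn_modDr => /eqP.
    by apply: P_inj; rewrite ?subP1 ?kb.
  + by move/(cross _ _ kP1 k'P2).
  + by move/esym/(cross _ _ k'P1 kP2).
  + have [[_ kP] [_ k'P]] := (inrem _ kP2, inrem _ k'P2).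
    have [[_ _ kb] [_ _ k'b]] := (inP2 _ kP, inP2 _ k'P).
    rewrite /F leqNgt kb leqNgt k'b /= => /eqP; rewrite eqn_modDl => /eqP.
    by apply: P_inj; rewrite ?subP2 ?(leqNgt _ b) ?kb ?k'b.
- move=> k; rewrite mem_cat => /orP[kP1|/inrem[_ kP2]].
    have [_ _ kb] := inP1 _ kP1; rewrite /F kb; apply/eqP; rewrite eqn_modDr.
    by apply/eqP; apply: P_class; apply: subP1.
  have [_ _ kb] := inP2 _ kP2; rewrite /F leqNgt kb /=; apply/eqP.
  by rewrite eqn_modDl; apply/eqP; apply: P_class; apply: subP2.
Qed.


Section MarkedSplice.
Variable eG : rel T.
Hypothesis eG_sub : subrel eG e.
Hypothesis eG_crit : forall p q, eG p q -> G q.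
Hypothesis eG_cls : forall p q, eG p q -> cls q = cls p + 1 %[mod g].
Hypothesis eG_connect : forall p q, G p -> G q -> connect eG p q.
Hypothesis eG_succ : forall p, G p -> exists q, eG p q.

Let cls_path p m : path eG p m -> cls (last p m) = cls p + size m %[mod g].
Proof.
elim: m p => [|q m IHm] p /=; first by rewrite addn0.
by case/andP=> epq /IHm ->; rewrite -modnDml (eG_cls epq) modnDml -addnA add1n.
Qed.

Let crit_path p q : G p -> G q -> exists q' m,
  [/\ path eG p (q' :: m), last p (q' :: m) = q, uniq (q' :: m)
    & (p == q) || (p \notin q' :: m)].
Proof.
move=> Gp Gq; have [<-|npq] := eqVneq p q.
  have [q' epq'] := eG_succ Gp.
  have /connectP[m0 pm lm] := eG_connect (eG_crit epq') Gp.
  case/shortenP: pm lm => m pm um _ lm.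
  by exists q', m; rewrite /= epq'.
have /connectP[m0 pm lm] := eG_connect Gp Gq.
case/shortenP: pm lm => -[|q' m] pm um _ lm; first by rewrite lm eqxx in npq.
by exists q', m; move: um; rewrite cons_uniq => /andP[-> ->].
Qed.

(* The quantity k - cls s_k mod g is constant along critical walks.  Between the
   first and last visits to G at which it takes a given value, s can be replaced
   by a simple critical path; if there is only one such visit, a critical cycle is
   inserted there.  Either way the new walk has two consecutive critical labels. *)
Lemma marked_splice : exists k k' p q m,
  [/\ k <= k', k' < size s, p = nth x0 s k, last p (q :: m) = nth x0 s k' &
   [/\ path eG p (q :: m), k' = k + size (q :: m) %[mod g], G p &
    forall x, count_mem x (splice s k k' (p :: q :: m))
                <= h + ~~ G x + (x == p)]].
Proof.
have [_ _ _ _ /hasP[x xs Gx]] := touch_s.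
pose b := index x s.
have bs : b < size s by rewrite index_mem.
have Gb : G (nth x0 s b) by rewrite nth_index.
pose z := nth x0 s b.
pose F k := [&& k < size s, G (nth x0 s k) &
                k + cls z == b + cls (nth x0 s k) %[mod g]].
have Fb : F b by apply/and3P; split.
have exF : exists k, F k by exists b.
have bF k : F k -> k <= size s by case/and3P => /ltnW.
case: (ex_minnP exF) => k Fk k_min; case: (ex_maxnP exF bF) => k' Fk' k'_max.
have [ks Gk /eqP ek] := and3P Fk; have [k's Gk' /eqP ek'] := and3P Fk'.
have kk' : k <= k' by apply: leq_trans (k_min _ Fb) (k'_max _ Fb).
set p := nth x0 s k in Gk ek; set p' := nth x0 s k' in Gk' ek'.
have [q [m [pm lm um npm]]] := crit_path Gk Gk'.
exists k, k', p, q, m; split => //.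
have szm : k' = k + size (q :: m) %[mod g].
  apply/eqP; rewrite -(eqn_modDr (cls z)) ek' (addnAC k) -(modnDml (k + cls z)).
  by rewrite ek modnDml -addnA -(modnDmr b) -lm (cls_path pm) modnDmr.
split=> // y; rewrite !count_cat addnCA.
have mG v : v \in q :: m -> G v.
  move: pm => /[swap] /splitPr[m1 m2]; rewrite cat_path /= => /and3P[_ ev _].
  exact: eG_crit ev.
have [Gy|nGy] := boolP (G y); last first.
  rewrite (count_memPn _) ?add0n; last first.
    by apply: contraNN nGy; rewrite inE => /predU1P[->|/mG].
  apply: leq_trans (_ : count_mem y s <= _); last first.
    by rewrite addn1 (leq_trans (count_noncritical y)) ?leq_addr.
  rewrite -[in leqRHS](cat_take_drop k s) count_cat leq_add2l.
  rewrite -(subnK (leq_trans kk' (leqnSn k'))) -drop_drop.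
  by rewrite -[in leqRHS](cat_take_drop (k'.+1 - k) (drop k s)) count_cat leq_addl.
rewrite addn0.
(* The residue v is the position at which y would take the value of the invariant belonging to z. By
   the choice of k and k' no visit to y outside the stretch is congruent to v, so v can be added to
   their residues and the bound h becomes strict. *)
have Gout : count_mem y (take k s) + count_mem y (drop k'.+1 s) < h.
  pose r := iota 0 k ++ iota k'.+1 (size s - k'.+1).
  have -> : count_mem y (take k s) + count_mem y (drop k'.+1 s) =
            size (positions y r).
    rewrite /positions filter_cat size_cat -!size_positions ?leqnn //; last first.
      by rewrite subn0 ltnW.
    by rewrite drop0 -[X in take X (drop k'.+1 s)]size_drop take_size.
  pose v := (b + cls y + g.-1 * cls z) %% g.
  have vz : v + cls z = b + cls y %[mod g].
    by rewrite modnDml -addnA -mulSnr prednK // mulnC addnC modnMDl.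
  have out i : i \in positions y r ->
      [/\ i < size s, nth x0 s i = y & (i < k) || (k' < i)].
    rewrite mem_positions mem_cat !mem_iota add0n subnKC //.
    case/andP=> /eqP sy /orP[/= ik|/andP[-> is_]]; last by rewrite orbT.
    by rewrite ik (ltn_trans ik ks).
  have r_uniq : uniq r.
    rewrite cat_uniq !iota_uniq andbT /=; apply/hasPn => i.
    rewrite !mem_iota add0n -leqNgt => /andP[ki _].
    exact: leq_trans kk' (ltnW ki).
  rewrite -[(size _).+1]/(size (v :: positions y r)).
  apply: (size_distinct_residues (F := id) (c := v %% gamma)).
  - rewrite cons_uniq filter_uniq // andbT; apply/negP => vr.
    have [vs vy vk] := out _ vr; have Fv : F v.
      by apply/and3P; rewrite vy; split=> //; apply/eqP.
    by have := k_min _ Fv; have := k'_max _ Fv; move: vk; clear; lia.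
  - have vP i : i \in positions y r -> v = i %[mod g] -> False.
      move=> /out[is_ iy ik] vi; have Fi : F i.
        apply/and3P; rewrite iy; split=> //.
        by rewrite -modnDml -vi modnDml vz.
      by have := k_min _ Fi; have := k'_max _ Fi; move: ik; clear; lia.
    move=> i j; rewrite !inE => /predU1P[->|ir] /predU1P[->|jr] //.
    + by move/(vP _ jr).
    + by move/esym/(vP _ ir).
    have [[is_ iy _] [js jy _]] := (out _ ir, out _ jr).
    by apply: critical_position_inj; rewrite ?iy ?jy.
  - move=> i; rewrite inE => /predU1P[->//|/out[is_ iy _]].
    apply/eqP; rewrite -(eqn_modDr (cls z)); apply/eqP.
    rewrite (modg vz) -(modnDmr i) (cls_gcl Gb) modnDmr.
    rewrite -(modnDmr b) (cls_gcl Gy) modnDmr -iy addnC (addnC b).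
    exact: (gcl_eq_nth x0 gclS).
(* The inserted walk is simple except that its end may repeat its start p, which accounts for the
   extra visit granted to p. *)
have cm : count_mem y (p :: q :: m) <= 1 + (y == p).
  have -> : count_mem y (p :: q :: m) = count_mem y (q :: m) + (y == p).
    by rewrite addnC [y == p]eq_sym.
  by rewrite leq_add2r count_uniq_mem ?leq_b1.
by move: Gout cm; clear; lia.
Qed.

End MarkedSplice.
End Minimal.

Lemma minimal_touching s0 : touching s0 ->
  exists2 s, touching s & forall s', touching s' -> size s <= size s'.
Proof.
move=> t0; have ex : exists n, `[< exists2 s, touching s & size s = n >].
  by exists (size s0); apply/asboolP; exists s0.
case: (ex_minnP ex) => n /asboolP[s ts <-] min_s; exists s => // s' ts'.
by apply: min_s; apply/asboolP; exists s'.
Qed.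

Lemma short_touching s0 : touching s0 ->
  exists2 s, touching s & size s + g <= g * (#|T| %/ gamma) + #|T|.
Proof.
move=> /minimal_touching[s ts min_s]; exists s => //.
have [_ ss _ _ _] := ts.
have := @size_of_counts s false x0 ss; rewrite muln0 addn0; apply=> p.
rewrite addn0; have [Gp|nGp] := boolP (G p).
  by rewrite addn0 (count_critical ts).
by rewrite addn1 (count_noncritical ts).
Qed.

Section Marked.
Variable eG : rel T.
Hypothesis eG_sub : subrel eG e.
Hypothesis eG_crit : forall p q, eG p q -> G q.
Hypothesis eG_cls : forall p q, eG p q -> cls q = cls p + 1 %[mod g].
Hypothesis eG_connect : forall p q, G p -> G q -> connect eG p q.
Hypothesis eG_succ : forall p, G p -> exists q, eG p q.

(** One critical label does not force a walk of nodes to meet the critical graph; two consecutive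
    ones p, q with [eG p q] do, since the node between them can be chosen critical. *)
Lemma short_marked s0 : touching s0 -> exists s1 p q s2,
  let s := s1 ++ p :: q :: s2 in
  [/\ touching s, eG p q &
      size s + g <= g * (#|T| %/ gamma) + #|T| + gamma].
Proof.
move=> /minimal_touching[s ts min_s].
have [k [k' [p [q [m [kk' k's hp lp [pm km Gp cs]]]]]]] :=
  marked_splice ts min_s eG_crit eG_cls eG_connect eG_succ.
exists (take k s), p, q, (m ++ drop k'.+1 s).
have tu : touching (splice s k k' (p :: q :: m)).
  apply: touching_splice => //; first exact: sub_path pm.
  by apply/hasP; exists p => //; rewrite mem_cat mem_head orbT.
split=> //; first by case/andP: pm.
by have [_ ss _ _ _] := tu; have := @size_of_counts _ true p ss cs; rewrite muln1.
Qed.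

End Marked.

End ShortWalks.

Import Order.TTheory GRing.Theory Num.Theory.
Local Open Scope ring_scope.

(** * Max-plus matrices and weights of walks *)

Section MaxPlusOrder.
Variable R : realType.
Implicit Types x y z : Rmax R.

Lemma rmax_le_refl x : rmax_le x x.
Proof. by case: x => //= a. Qed.

Lemma rmax_le_trans y x z : rmax_le x y -> rmax_le y z -> rmax_le x z.
Proof. by case: x y z => [a|] [b|] [c|] //=; apply: le_trans. Qed.

Lemma rmax_le_addr x y : rmax_le x (x + y).
Proof. by case: x y => [a|] [b|] //=; rewrite le_max lexx. Qed.

Lemma rmax_addP x y : {x + y = x} + {x + y = y}.
Proof.
case: x y => [a|] [b|]; rewrite /GRing.add /=; [|by left|by right|by left].
by rewrite maxEle; case: ifP => _; [right|left].
Qed.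

Lemma rmax_le_mul x y x' y' :
  rmax_le x x' -> rmax_le y y' -> rmax_le (x * y) (x' * y').
Proof. by case: x x' y y' => [a|] [a'|] [b|] [b'|] //=; apply: lerD. Qed.

Lemma rmax_le_sum (I : eqType) (r : seq I) (P : pred I) (F : I -> Rmax R) i :
  i \in r -> P i -> rmax_le (F i) (\sum_(j <- r | P j) F j).
Proof.
elim: r => // j r IHr; rewrite inE big_cons => /predU1P[<- ->|ir Pi].
  exact: rmax_le_addr.
case: ifP => _; last exact: IHr.
by apply: rmax_le_trans (IHr ir Pi) _; rewrite addrC; apply: rmax_le_addr.
Qed.

Lemma rmax_sum_attained (I : eqType) (r : seq I) (P : pred I) (F : I -> Rmax R)
    v : \sum_(j <- r | P j) F j = Some v ->
  exists i, [/\ i \in r, P i & F i = Some v].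
Proof.
elim: r => [|j r IHr]; first by rewrite big_nil.
rewrite big_cons; case: ifP => Pj; last first.
  by move=> /IHr[i [ir Pi Fi]]; exists i; rewrite inE ir orbT.
case: (rmax_addP (F j) (\sum_(k <- r | P k) F k)) => -> Fv.
  by exists j; rewrite mem_head.
by have [i [ir Pi Fi]] := IHr Fv; exists i; rewrite inE ir orbT.
Qed.

Lemma rmax_prod (I : eqType) (r : seq I) (F : I -> Rmax R) :
  {in r, forall i, F i != ninf} ->
  \prod_(i <- r) F i = Some (\sum_(i <- r) fin_part (F i)).
Proof.
elim: r => [|i r IHr] Fr; first by rewrite !big_nil.
rewrite !big_cons IHr; last by move=> j jr; apply: Fr; rewrite inE jr orbT.
by have := Fr i (mem_head _ _); case: (F i).
Qed.

Lemma rmax_expr (a : R) n : (Some a : Rmax R) ^+ n = Some (n%:R * a).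
Proof.
elim: n => [|n IHn]; first by rewrite mul0r.
by rewrite exprS IHn -[n.+1%:R]natr1 mulrDl mul1r addrC.
Qed.

End MaxPlusOrder.

Section Weights.
Variables (R : realType) (T : Type).
Implicit Types (f : T -> T -> R) (x : T) (s : seq T).

Fixpoint wt f x s : R := if s is y :: s' then f x y + wt f y s' else 0.

Lemma wt_cat f x s1 s2 : wt f x (s1 ++ s2) = wt f x s1 + wt f (last x s1) s2.
Proof. by elim: s1 x => [|y s1 IH] x /=; rewrite ?add0r // IH addrA. Qed.

Lemma wt_shift f (l : R) x s :
  wt (fun u v => f u v - l) x s = wt f x s - (size s)%:R * l.
Proof.
elim: s x => [|y s IH] x /=; first by rewrite mul0r subr0.
by rewrite IH -[(size s).+1%:R]natr1 mulrDl mul1r; ring.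
Qed.

End Weights.

Section NextSums.
Variables (R : realType) (T : eqType).

(** The return node [y0] stays fixed while the induction moves the head; the cycle is the case where
    it equals x. *)
Lemma sum_next_at (f : T -> T -> R) y0 x c : uniq (x :: c) ->
  \sum_(z <- x :: c) f z (next_at z y0 x c) = wt f x (rcons c y0).
Proof.
elim: c x => [|y c IHc] x; first by rewrite big_seq1 /= eqxx addr0.
rewrite cons_uniq big_cons => /andP[xyc uyc] /=.
rewrite eqxx; congr (_ + _); rewrite -IHc //.
rewrite [LHS]big_seq [RHS]big_seq; apply: eq_bigr => z zc /=.
by rewrite eq_sym; case: eqP => // zx; rewrite zx zc in xyc.
Qed.

Lemma sum_next (f : T -> T -> R) x c : uniq (x :: c) ->
  \sum_(z <- x :: c) f z (next (x :: c) z) = wt f x (rcons c x).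
Proof. exact: sum_next_at. Qed.

End NextSums.

Section MatrixWalks.
Variables (R : realType) (d : nat).
Implicit Types A B : 'M[Rmax R]_d.

Definition entry A i j : R := fin_part (A i j).

Lemma entryE A i j : has_arc A i j -> A i j = Some (entry A i j).
Proof. by rewrite /has_arc /entry; case: (A i j) => //; rewrite eqxx. Qed.

Lemma mulmx_ge n m p (A : 'M[Rmax R]_(n, m)) (B : 'M_(m, p)) i k j a b :
  rmax_le a (A i k) -> rmax_le b (B k j) -> rmax_le (a * b) ((A *m B) i j).
Proof.
move=> aA bB; apply: rmax_le_trans (rmax_le_mul aA bB) _; rewrite mxE.
exact: (rmax_le_sum (P := predT) (fun k => A i k * B k j) (mem_index_enum k)). 
Qed.

Lemma mulmx_attained n m p (A : 'M[Rmax R]_(n, m)) (B : 'M_(m, p)) i j v :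
  (A *m B) i j = Some v ->
  exists k a b, [/\ A i k = Some a, B k j = Some b & v = a + b].
Proof.
rewrite mxE => /rmax_sum_attained[k [_ _]]; exists k; move: p0.
by case: (A i k) (B k j) => [a|] [b|] // [<-]; exists a, b.
Qed.

Lemma expmx_ge A i s : path (has_arc A) i s ->
  rmax_le (Some (wt (entry A) i s)) ((A ^+ size s) i (last i s)).
Proof.
elim: s i => [|j s IHs] i.
  by rewrite expr0 mxE eqxx mulr1n => _; apply: (rmax_le_refl (Some 0)).
case/andP=> /entryE Aij /IHs le; rewrite exprS.
by apply: (mulmx_ge (a := Some (entry A i j)) _ le); rewrite Aij rmax_le_refl.
Qed.

Lemma expmx_attained A t i j v : (A ^+ t) i j = Some v ->
  exists s, [/\ path (has_arc A) i s, last i s = j, size s = t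
              & wt (entry A) i s = v].
Proof.
elim: t i v => [|t IHt] i v.
  by rewrite mxE; case: eqP => // -> [<-]; exists [::].
rewrite exprS => /mulmx_attained[k [a [b [Aik /IHt[s [ps ls zs ws]] ->]]]].
exists (k :: s); split=> //=; rewrite ?zs ?ws ?/has_arc ?Aik //.
by rewrite /entry Aik.
Qed.

Lemma scalemx_entry A (l : R) i j : has_arc A i j ->
  (rmax_inv (Some l) *: A) i j = Some (entry A i j - l).
Proof. by move=> /entryE Aij; rewrite mxE Aij addrC. Qed.

Lemma scalemx_has_arc A (l : R) :
  has_arc (rmax_inv (Some l) *: A) =2 has_arc A.
Proof. by move=> i j; rewrite /has_arc mxE; case: (A i j). Qed.

End MatrixWalks.

(** * Maximum cycle mean, critical graph and CSR terms *)

Section WeightBounds.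
Variables (R : realType) (T : finType) (e : rel T) (f : T -> T -> R) (m : R).

Lemma wt_le x s : (forall u v, e u v -> f u v <= m) -> path e x s ->
  wt f x s <= (size s)%:R * m.
Proof.
move=> fm; elim: s x => [|y s IHs] x /=; first by rewrite mul0r.
case/andP=> /fm le1 /IHs le2; rewrite -[(size s).+1%:R]natr1 mulrDl mul1r addrC.
exact: lerD.
Qed.

Lemma wt_ge x s : (forall u v, e u v -> m <= f u v) -> path e x s ->
  (size s)%:R * m <= wt f x s.
Proof.
move=> fm; elim: s x => [|y s IHs] x /=; first by rewrite mul0r.
case/andP=> /fm le1 /IHs le2; rewrite -[(size s).+1%:R]natr1 mulrDl mul1r addrC.
exact: lerD.
Qed.

Hypothesis cycle_le : forall x c, x :: c \in simple_cycles e ->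
  wt f x (rcons c x) <= (size c).+1%:R * m.

(** Remove simple cycles one at a time: each accounts for at most m per arc removed. *)
Lemma walk_reduce x s : path e x s -> exists s',
  [/\ path e x s', last x s' = last x s, uniq (x :: s'), (size s' <= size s)%N
    & wt f x s <= wt f x s' + ((size s)%:R - (size s')%:R) * m].
Proof.
move: {2}(size s).+1 (ltnSn (size s)) => n.
elim: n => // n IHn in s *; rewrite ltnS => szs ps.
have [us|nus] := boolP (uniq (x :: s)).
  by exists s; rewrite subrr mul0r addr0.
have [s1 [c [s2 /=]]] := walk_loop ps nus; set z := last x s1 => -[def_s uc pc].
have sz : size s = (size (s1 ++ s2) + (size c).+1)%N.
  by rewrite def_s !size_cat size_rcons; lia.
have lt : (size (s1 ++ s2) < n)%N by apply: leq_trans szs; rewrite sz; lia.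
have ps12 : path e x (s1 ++ s2).
  move: ps; rewrite def_s !cat_path -/z last_rcons.
  by case/and3P => -> _ ->.
have [s' [ps' ls' us' zs' ws']] := IHn _ lt ps12.
exists s'; split=> //.
- by rewrite ls' def_s !last_cat last_rcons.
- by apply: leq_trans zs' _; rewrite sz leq_addr.
have cle : wt f z (rcons c z) <= (size c).+1%:R * m.
  by apply: cycle_le; rewrite mem_simple_cycles /= uc.
have -> : wt f x s = wt f x (s1 ++ s2) + wt f z (rcons c z).
  by rewrite def_s !wt_cat last_rcons -/z; ring.
apply: le_trans (lerD ws' cle) _.
by rewrite sz natrD; lra.
Qed.

End WeightBounds.

(** * The maximum cycle mean and weights of long walks *)

Section Spectrum.
Variables (R : realType) (d : nat).
Implicit Types (A B : 'M[Rmax R]_d) (l : R).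

Lemma cycle_meanE A c : c \in simple_cycles (has_arc A) ->
  cycle_mean A c =
    Some ((\sum_(z <- c) entry A z (next c z)) / (size c)%:R).
Proof.
rewrite mem_filter mem_uniq_seqs => /and3P[cc _ uc].
rewrite /cycle_mean /cycle_weight rmax_prod // => z zc.
exact: next_cycle cc zc.
Qed.

Lemma simple_cycle_neq0 A c : c \in simple_cycles (has_arc A) ->
  (0 : R) < (size c)%:R.
Proof.
rewrite mem_filter mem_uniq_seqs => /and3P[_ c0 _].
by rewrite ltr0n lt0n size_eq0.
Qed.

Lemma cycle_le_lambda A l x c : lambda A = Some l ->
  x :: c \in simple_cycles (has_arc A) ->
  wt (entry A) x (rcons c x) <= (size c).+1%:R * l.
Proof.
move=> def_l cA.
have := @rmax_le_sum _ _ _ predT (cycle_mean A) _ cA isT.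
rewrite -/(lambda A) def_l cycle_meanE // /= ler_pdivrMr ?(simple_cycle_neq0 cA) //.
rewrite sum_next; first by rewrite mulrC.
by move: cA; rewrite mem_simple_cycles => /andP[].
Qed.

Lemma lambda_attained A l : lambda A = Some l ->
  exists2 c, c \in critical_cycles A &
    \sum_(z <- c) entry A z (next c z) = (size c)%:R * l.
Proof.
move=> def_l; have := def_l; rewrite /lambda => /rmax_sum_attained[c [cA _ mean_c]].
exists c; first by rewrite mem_filter mean_c def_l eqxx.
move: mean_c; rewrite cycle_meanE // => -[<-].
by rewrite mulrC divfK // gt_eqF // (simple_cycle_neq0 cA).
Qed.

Lemma entry_le_max A i j : has_arc A i j -> entry A i j <= fin_part (max_entry A).
Proof.
move=> Aij; have le1 : rmax_le (A i j) (max_entry A).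
  apply: rmax_le_trans (rmax_le_sum (P := predT) (fun i => \sum_j A i j) (mem_index_enum i) isT).
  exact: (rmax_le_sum (P := predT) (fun j => A i j) (mem_index_enum j)).
by move: le1; rewrite (entryE Aij); case: (max_entry A).
Qed.

Lemma min_le_entry A i j : has_arc A i j -> min_fin_entry A <= entry A i j.
Proof.
move=> Aij; rewrite /min_fin_entry (bigD1 (i, j)) //=.
by rewrite ge_min lexx.
Qed.

Lemma lambda_le_max A l : lambda A = Some l -> l <= fin_part (max_entry A).
Proof.
move=> /lambda_attained[c]; rewrite mem_filter => /andP[_ cA] sum_c.
have c0 := simple_cycle_neq0 cA.
case: c => [|x c] // in cA sum_c c0 *; first by rewrite ltxx in c0.
move: cA; rewrite mem_simple_cycles => /andP[uc pc].
rewrite -(ler_pM2l c0) -sum_c sum_next //.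
by have := wt_le (@entry_le_max A) pc; rewrite size_rcons.
Qed.

Lemma le_lambda A l m : lambda A = Some l ->
  (forall i j, has_arc A i j -> m <= entry A i j) -> m <= l.
Proof.
move=> /lambda_attained[c]; rewrite mem_filter => /andP[_ cA] sum_c Am.
have c0 := simple_cycle_neq0 cA.
case: c => [|x c] // in cA sum_c c0 *; first by rewrite ltxx in c0.
move: cA; rewrite mem_simple_cycles => /andP[uc pc].
rewrite -(ler_pM2l c0) -sum_c sum_next //.
by have := wt_ge Am pc; rewrite size_rcons.
Qed.

(** The cycles removed have mean at most l, and the simple walk that remains has at most
    [longest_path] arcs, each exceeding l by at most the nonnegative difference of the largest entry
    and l. *)
Lemma walk_weight_le B l i s : lambda B = Some l -> path (has_arc B) i s ->
  wt (entry B) i s <= (size s)%:R * l +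
    (longest_path (has_arc B))%:R * (fin_part (max_entry B) - l).
Proof.
move=> def_l ps.
have [s' [ps' _ us' zs' ws']] :=
  walk_reduce (fun x c => @cycle_le_lambda B l x c def_l) ps.
have le_cd : (size s' <= longest_path (has_arc B))%N.
  have inp : i :: s' \in simple_paths (has_arc B).
    by rewrite mem_filter mem_uniq_seqs /= ps'.
  exact: (@leq_bigmax_seq _ _ predT (fun p => (size p).-1) _ inp isT).
have le1 := wt_le (@entry_le_max B) ps'.
have le2 : (size s')%:R * (fin_part (max_entry B) - l) <=
    (longest_path (has_arc B))%:R * (fin_part (max_entry B) - l).
  by apply: ler_wpM2r; rewrite ?subr_ge0 ?lambda_le_max ?ler_nat.
apply: le_trans ws' _; move: le1 le2; rewrite mulrBl !mulrBr.
by move: (wt _ _ _) => v; lra.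
Qed.

End Spectrum.

(** The arc weights after normalising the maximum cycle mean to 0. *)
Definition excess (R : realType) (d : nat) (A : 'M[Rmax R]_d) (l : R) i j : R :=
  entry A i j - l.

Lemma wt_excess (R : realType) (d : nat) (A : 'M[Rmax R]_d) (l : R) x s :
  wt (excess A l) x s = wt (entry A) x s - (size s)%:R * l.
Proof. exact: wt_shift. Qed.

(** * Critical walks and lower bounds on CSR entries *)

Section Critical.
Variables (R : realType) (d : nat) (A : 'M[Rmax R]_d) (l : R).
Hypothesis lambdaA : lambda A = Some l.
Notation e := (has_arc A).
Notation ec := (crit_arc A).

Notation w := (excess A l).

Let excess_cycle_le x c : x :: c \in simple_cycles e ->
  wt w x (rcons c x) <= (size c).+1%:R * 0.
Proof.
move=> cA; rewrite wt_excess size_rcons mulr0 subr_le0.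
exact: cycle_le_lambda.
Qed.

(** Removing cycles of nonpositive weight from a closed walk ends at the empty walk, the only simple
    one returning to x. *)
Lemma closed_walk_le0 x s : path e x s -> last x s = x -> wt w x s <= 0.
Proof.
move=> ps ls.
have [s' [ps' ls' us' _ ws']] := walk_reduce excess_cycle_le ps.
move: ws'; rewrite mulr0 addr0 => /le_trans; apply.
case: s' ls' us' {ps'} => // y s' ls' /= /andP[xs' _].
by rewrite -{1}ls -ls' /= mem_last in xs'.
Qed.

Lemma critical_cycle_rot c x : c \in critical_cycles A -> x \in c ->
  exists c0, [/\ path e x (rcons c0 x), path ec x (rcons c0 x), uniq (x :: c0),
    wt w x (rcons c0 x) = 0 & next c x = head x (rcons c0 x)].
Proof.
rewrite mem_filter => /andP[/eqP mean_c cA] xc.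
have cc : c \in critical_cycles A by rewrite mem_filter mean_c eqxx.
move: (cA); rewrite mem_filter mem_uniq_seqs => /and3P[ce _ uc].
have c0 := simple_cycle_neq0 cA.
have sum_c : \sum_(z <- c) w z (next c z) = 0.
  rewrite big_split /= sumrN big_const_seq count_predT iter_addr_0.
  move: mean_c; rewrite cycle_meanE // lambdaA => -[mean_c].
  by rewrite -mean_c -[X in _ - X]mulr_natr divfK ?subrr ?gt_eqF.
have cec : cycle ec c.
  have : fcycle (next c) c by apply: cycle_next.
  apply: sub_in_cycle (allss c) => y z yc zc /eqP yz.
  by apply/hasP; exists c => //; rewrite yc yz eqxx.
have [k c1 rot_c] := rot_to xc; exists c1.
have uc1 : uniq (x :: c1) by rewrite -rot_c rot_uniq.
split.
- by rewrite -[path _ _ _]/(cycle e (x :: c1)) -rot_c rot_cycle.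
- by rewrite -[path _ _ _]/(cycle ec (x :: c1)) -rot_c rot_cycle.
- exact: uc1.
- rewrite -sum_next // -[RHS]sum_c -rot_c.
  have prot : perm_eq (rot k c) c by rewrite perm_rot.
  rewrite (perm_big _ prot) /=.
  by apply: eq_bigr => z _; rewrite next_rot.
rewrite -(next_rot k uc) rot_c /next; case: (c1) => [|y c2] /=; by rewrite eqxx.
Qed.

Lemma crit_arc_return x y : ec x y ->
  e x y /\ exists s, [/\ path ec y s, last y s = x & w x y + wt w y s = 0].
Proof.
move=> /hasP[c cc /andP[xc /eqP def_y]].
have [c0 [pe pec _ w0 nx]] := critical_cycle_rot cc xc.
rewrite def_y in nx.
case: c0 pe pec w0 nx => [|z c0] /=.
  rewrite andbT => exx ecx w0 ->; split=> //; exists [::].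
  by split.
move=> /andP[exz _] /andP[_ pec] w0 ->; split=> //; exists (rcons c0 x).
by rewrite last_rcons.
Qed.

Lemma sub_crit_arc : subrel ec e.
Proof. by move=> x y /crit_arc_return[]. Qed.

(** Each arc is undone by the rest of a critical cycle through it; these returns, taken in reverse
    order, lead back to x. *)
Lemma crit_walk_return x s : path ec x s ->
  exists s', [/\ path ec (last x s) s', last (last x s) s' = x
                & wt w x s + wt w (last x s) s' = 0].
Proof.
elim: s x => [|y s IHs] x /=; first by exists [::]; rewrite /= addr0.
case/andP=> /crit_arc_return[_ [r [pr lr wr]]] /IHs[s' [ps' ls' ws']].
exists (s' ++ r); rewrite cat_path last_cat ls' ps' lr; split=> //.
by rewrite wt_cat ls' -wr -[in RHS](addr0 (wt w y r)) -ws'; ring.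
Qed.

Lemma crit_connect_sym x y : connect ec x y -> connect ec y x.
Proof.
case/connectP=> s /crit_walk_return[s' [ps' ls' _]] ->.
by apply/connectP; exists s'.
Qed.

(** The walk and its critical return are both closed at x, so neither has positive weight, while
    their weights add up to 0. *)
Lemma closed_crit_walk0 x s : path ec x s -> last x s = x -> wt w x s = 0.
Proof.
move=> ps ls; have [s' []] := crit_walk_return ps; rewrite ls => ps' ls' ws'.
have := closed_walk_le0 (sub_path sub_crit_arc ps) ls.
have := closed_walk_le0 (sub_path sub_crit_arc ps') ls'.
by lra.
Qed.

(* Removing cycles from the walk y -> x, none of which has positive weight, leaves
   a simple cycle of weight 0 through the arc. *)
Lemma closed_walk_crit_arc x y s : e x y -> path e y s -> last y s = x ->
  0 <= w x y + wt w y s -> ec x y.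
Proof.
move=> exy ps ls ws.
have [s' [ps' ls' us' _ ws']] := walk_reduce excess_cycle_le ps.
rewrite mulr0 addr0 in ws'; rewrite ls in ls'.
pose c := x :: belast y s'.
have def_s' : y :: s' = rcons (belast y s') x by rewrite lastI ls'.
have uc : uniq c by rewrite /c cons_uniq -rcons_uniq -def_s'.
have pc : path e x (rcons (belast y s') x) by rewrite -def_s' /= exy.
have cA : c \in simple_cycles e by rewrite mem_simple_cycles uc pc.
have w0 : wt w x (rcons (belast y s') x) = 0.
  apply/le_anti/andP; split.
    by apply: closed_walk_le0 pc _; rewrite last_rcons.
  by rewrite -def_s' /= (le_trans ws) // lerD2l.
apply/hasP; exists c; last first.
  by rewrite mem_head /c; case: (s') ls' => [/= ->|z s''] /=; rewrite eqxx.
rewrite mem_filter cA andbT cycle_meanE // lambdaA; apply/eqP; congr Some.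
rewrite sum_next //; move: w0; rewrite wt_excess size_rcons => /subr0_eq ->.
by rewrite -[(size _).+1]/(size c) mulrC mulKf // gt_eqF // (simple_cycle_neq0 cA).
Qed.

Lemma crit_node_cycle x : crit_node A x ->
  exists2 c, path ec x (rcons c x) & uniq (x :: c).
Proof.
case/hasP=> c cc xc; have [c0 [_ pec uc _ _]] := critical_cycle_rot cc xc.
by exists c0.
Qed.

Lemma crit_node_arc x : crit_node A x -> exists y, ec x y.
Proof.
by case/crit_node_cycle=> -[|y c] /= /andP[exy _]; [exists x | exists y].
Qed.

Lemma crit_arc_nodes x y : ec x y -> crit_node A x /\ crit_node A y.
Proof.
case/hasP=> c cc /andP[xc /eqP <-].
by split; apply/hasP; exists c => //; rewrite mem_next.
Qed.

Lemma crit_node_connect x y : crit_node A x -> connect ec x y -> crit_node A y.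
Proof.
move=> cx /connectP[s ps ->]; elim: s x cx ps => //= y' s IHs x _.
by case/andP=> /crit_arc_nodes[_ /IHs].
Qed.

Lemma crit_walk_exists x n : crit_node A x ->
  exists2 s, path ec x s & size s = n.
Proof.
elim: n x => [|n IHn] x cx; first by exists [::].
have [y exy] := crit_node_arc cx; have [_ /IHn[s ps <-]] := crit_arc_nodes exy.
by exists (y :: s); rewrite //= exy.
Qed.

Lemma scc_crit_gt0 x : crit_node A x -> (0 < scc_cyclicity ec x)%N.
Proof.
case/crit_node_cycle=> c pc _.
have : (scc_cyclicity ec x %| size (rcons c x))%N.
  by apply: (dvdn_closed_walk crit_connect_sym) pc _; rewrite ?last_rcons.
by rewrite size_rcons => /dvdn_gt0; apply.
Qed.

Lemma crit_cyclicity_gt0 : (0 < crit_cyclicity A)%N.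
Proof.
rewrite /crit_cyclicity /cyclicity; elim/big_ind: _ => // [m n|x /scc_crit_gt0//].
by rewrite lcmn_gt0 => -> ->.
Qed.

Lemma dvdn_crit_cyclicity x : crit_node A x ->
  (scc_cyclicity ec x %| crit_cyclicity A)%N.
Proof.
by move=> cx; rewrite /crit_cyclicity /cyclicity (bigD1 x) //= dvdn_lcml.
Qed.

Let X := rmax_inv (lambda A) *: A.

Let X_walk i s : path e i s -> path (has_arc X) i s /\
  wt (entry X) i s = wt w i s.
Proof.
elim: s i => [|j s IHs] i //= /andP[eij /IHs[-> ->]].
rewrite /X lambdaA scalemx_has_arc eij; split=> //; congr (_ + _).
by rewrite /entry (scalemx_entry l eij).
Qed.

Let X_attained t i j v : (X ^+ t) i j = Some v ->
  exists s, [/\ path e i s, last i s = j, size s = t & wt w i s = v].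
Proof.
move=> /expmx_attained[s [ps ls zs ws]]; exists s.
have pe : path e i s.
  by rewrite -(eq_path (scalemx_has_arc A l)) -lambdaA.
by split=> //; rewrite -ws (X_walk pe).2.
Qed.

(** This makes the supremum in [kleene_star] a genuine one. Cycles only lower the excess, and a
    simple walk has fewer than d arcs. *)
Lemma excess_walk_bounded : exists b, forall i s, path e i s -> wt w i s <= b.
Proof.
pose mx := Num.max 0 (fin_part (max_entry A) - l).
exists (d%:R * mx) => i s ps.
have [s' [ps' _ us' _]] := walk_reduce excess_cycle_le ps; rewrite mulr0 addr0 => /le_trans; apply.
have w_le u v : e u v -> w u v <= mx.
  by move=> /entry_le_max le; rewrite le_max lerD2r le orbT.
apply: le_trans (wt_le w_le ps') _; apply: ler_wpM2r.
  by rewrite le_max lexx.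
rewrite ler_nat; apply: leq_trans (leqnSn _) _.
by rewrite -[(size s').+1]/(size (i :: s')) -(card_uniqP us') -[leqRHS]card_ord max_card.
Qed.

Lemma csr_M_ge i s k : path e i s -> size s = (k * crit_cyclicity A)%N ->
  rmax_le (Some (wt w i s)) (csr_M A i (last i s)).
Proof.
move=> ps szs; have [pX wX] := X_walk ps.
have := expmx_ge pX; rewrite wX szs mulnC exprM.
rewrite /csr_M /kleene_star mxE -/X.
case def_v: ((X ^+ crit_cyclicity A ^+ k) i (last i s)) => [v|] // le_v.
rewrite ifT; last by apply/asboolP; exists k; rewrite def_v.
apply: le_trans le_v _; apply: ub_le_sup; last by exists k.
have [b wb] := excess_walk_bounded; exists b => x [k'].
by rewrite -exprM => /X_attained[s' [ps' _ _ <-]]; apply: wb.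
Qed.

Lemma csr_S_ge x s : path ec x s ->
  rmax_le (Some (wt w x s)) ((csr_S A ^+ size s) x (last x s)).
Proof.
have SE y z : ec y z -> csr_S A y z = Some (w y z).
  move=> ecyz; rewrite mxE ecyz lambdaA.
  by rewrite (entryE (sub_crit_arc ecyz)).
have S_walk y s' : path ec y s' -> path (has_arc (csr_S A)) y s' /\
    wt (entry (csr_S A)) y s' = wt w y s'.
  elim: s' y => [|z s' IHs] y //= /andP[ecyz /IHs[-> ->]].
  by rewrite /has_arc /entry SE.
by move=> /S_walk[pS <-]; apply: expmx_ge.
Qed.

(* Walks on from x along critical arcs until the length of s1 is completed to a
   multiple of sigma, for t more steps, and back to x so that s2 is completed to a
   multiple of sigma: the critical detour is closed, hence of weight 0. *)
Lemma csr_ge x0 x i j s1 s2 t : crit_node A x0 -> connect ec x0 x ->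
  path e i s1 -> last i s1 = x -> path e x s2 -> last x s2 = j ->
  (size s1 + size s2 = t %[mod scc_cyclicity ec x0])%N ->
  rmax_le (Some (wt w i s1 + wt w x s2))
    ((csr_C A *m csr_S A ^+ t *m csr_R A) i j).
Proof.
move=> cx0 x0x p1 l1 p2 l2 szt; set sg := crit_cyclicity A.
have [cls [_ clsD cls_walk]] := cyclic_classes crit_connect_sym (scc_crit_gt0 cx0).
set g := scc_cyclicity ec x0 in szt clsD cls_walk.
have sg0 : (0 < sg)%N := crit_cyclicity_gt0.
have gsg : (g %| sg)%N := dvdn_crit_cyclicity cx0.
have cx : crit_node A x := crit_node_connect cx0 x0x.
have [c1 pc1 zc1] := crit_walk_exists (sg.-1 * size s1) cx.
have xk1 := path_connect pc1; set k1 := last x c1 in xk1.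
have ck1 : crit_node A k1 := crit_node_connect cx xk1.
have [c2 pc2 zc2] := crit_walk_exists t ck1.
have xk2 := path_connect pc2; set k2 := last k1 c2 in xk2.
have ck2 : crit_node A k2 := crit_node_connect ck1 xk2.
have x0k1 := connect_trans x0x xk1; have x0k2 := connect_trans x0k1 xk2.
have [|c3 [pc3 lc3 zc3]] := cls_walk k2 x sg (sg.-1 * size s2)%N sg0 x0k2 x0x.
  have d0 : (g %| sg.-1 * size s1 + t + sg.-1 * size s2)%N.
    rewrite addnAC -mulnDr /dvdn -modnDmr -szt modnDmr -mulSnr prednK //.
    exact: dvdn_mulr.
  have ck2E := clsD _ _ x0k1 pc2; have ck1E := clsD _ _ x0x pc1.
  rewrite -modnDml ck2E modnDml -addnA -modnDml ck1E modnDml zc1 zc2.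
  move: d0; rewrite -!addnA /dvdn => /eqP d0.
  by rewrite -[in RHS]modnDmr d0 addn0.
have p11 : path e i (s1 ++ c1).
  by rewrite cat_path p1 l1 (sub_path sub_crit_arc pc1).
have p32 : path e k2 (c3 ++ s2).
  by rewrite cat_path lc3 p2 (sub_path sub_crit_arc pc3).
have M1 : rmax_le (Some (wt w i (s1 ++ c1))) (csr_C A i k1).
  rewrite mxE ck1; have -> : k1 = last i (s1 ++ c1) by rewrite last_cat l1.
  apply: (csr_M_ge (k := size s1) p11).
  by rewrite size_cat zc1 -mulSn prednK // mulnC.
have [q zc3s2] : exists q, size (c3 ++ s2) = (q * sg)%N.
  apply/dvdnP; rewrite /dvdn size_cat -modnDml zc3 modnDml -mulSnr prednK //.
  by rewrite mulnC modnMl.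
have M2 : rmax_le (Some (wt w k2 (c3 ++ s2))) (csr_R A k2 j).
  rewrite mxE ck2; have -> : j = last k2 (c3 ++ s2) by rewrite last_cat lc3.
  exact: (csr_M_ge p32 zc3s2).
have MS : rmax_le (Some (wt w k1 c2)) ((csr_S A ^+ t) k1 k2).
  by rewrite -zc2; apply: csr_S_ge.
have := mulmx_ge (mulmx_ge M1 MS) M2; apply: rmax_le_trans.
have closed0 : wt w x (c1 ++ c2 ++ c3) = 0.
  apply: closed_crit_walk0; last by rewrite !last_cat.
  by rewrite !cat_path pc1 pc2.
move: closed0; rewrite !wt_cat l1 lc3 -/k1 -/k2 => closed0.
have -> : wt w i s1 + wt w x s2 =
   wt w i s1 + wt w x c1 + wt w k1 c2 + (wt w k2 c3 + wt w x s2).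
  by rewrite -[LHS]addr0 -closed0; ring.
exact: rmax_le_refl.
Qed.

End Critical.

(** * Short walks through the critical graph *)

Lemma mem_pairmap (S T : eqType) (f : T -> T -> S) x s p :
  p \in pairmap f x s ->
  exists s1 y s2, s = s1 ++ y :: s2 /\ p = f (last x s1) y.
Proof.
elim: s x => // y s IHs x; rewrite inE => /predU1P[->|/IHs[s1 [z [s2 [-> ->]]]]].
  by exists [::], y, s.
by exists (y :: s1), z, s2.
Qed.

Section Cyclicity.
Variables (R : realType) (d : nat) (A : 'M[Rmax R]_d).
Hypothesis A_irr : irreducible A.
Notation e := (has_arc A).

Lemma mx_cyclicityE x : mx_cyclicity A = scc_cyclicity e x.
Proof.
have sccE y : scc_cyclicity e y = scc_cyclicity e x.
  by apply: eq_bigl => c; apply: eq_all => z; rewrite !A_irr.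
rewrite /mx_cyclicity /cyclicity (eq_bigr (fun=> scc_cyclicity e x)) //.
rewrite (bigD1 x) //=; elim/big_rec: _ => [|y m _ IH]; first by rewrite lcmn1.
rewrite IH; apply/eqP.
by rewrite eqn_dvd dvdn_lcm !dvdnn dvdn_lcml.
Qed.

End Cyclicity.

Section Routes.
Variables (R : realType) (d : nat) (A : 'M[Rmax R]_d) (l : R) (x0 : 'I_d).
Hypotheses (A_irr : irreducible A) (lambdaA : lambda A = Some l).
Hypothesis crit0 : crit_node A x0.
Notation e := (has_arc A).
Notation ec := (crit_arc A).
Notation w := (excess A l).
Notation gamma := (mx_cyclicity A).
Notation g := (scc_cyclicity ec x0).
Notation G := (connect ec x0).

Let A_sym x y : connect e x y -> connect e y x. Proof. by []. Qed.

Let g_gt0 : (0 < g)%N. Proof. exact: scc_crit_gt0 lambdaA _ crit0. Qed.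

Let ec_sym := crit_connect_sym lambdaA.
Let ec_sub := sub_crit_arc lambdaA.

Let G_crit x : G x -> crit_node A x.
Proof. exact: crit_node_connect. Qed.

Let closed_gamma s : path e x0 s -> last x0 s = x0 -> (gamma %| size s)%N.
Proof.
move=> ps ls; rewrite (mx_cyclicityE A_irr x0).
by apply: (dvdn_closed_walk A_sym (connect0 e x0)).
Qed.

Lemma mx_cyclicity_gt0 : (0 < gamma)%N.
Proof.
have [c pc _] := crit_node_cycle lambdaA crit0.
have := closed_gamma (sub_path ec_sub pc); rewrite last_rcons size_rcons.
by move=> /(_ erefl) /dvdn_gt0; apply.
Qed.

(** A closed critical walk whose length is [g] modulo [gamma * g] is also a closed walk of A, so
    [gamma] divides its length and therefore [g]. *)
Lemma dvdn_mx_cyclicity : (gamma %| g)%N.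
Proof.
have gg0 : (0 < gamma * g)%N by rewrite muln_gt0 mx_cyclicity_gt0.
have [s [ps ls szs]] := closed_walk_mod ec_sym gg0 (connect0 ec x0) 1.
have := closed_gamma (sub_path ec_sub ps) ls; rewrite mul1n in szs.
by rewrite /dvdn -(modn_dvdm _ (dvdn_mulr g (dvdnn gamma))) szs modn_dvdm ?dvdn_mulr.
Qed.

Let h := (g %/ gamma)%N.

Let gE : g = (gamma * h)%N.
Proof. by rewrite mulnC divnK // dvdn_mx_cyclicity. Qed.

Let h_gt0 : (0 < h)%N.
Proof. by have := g_gt0; rewrite gE muln_gt0 => /andP[]. Qed.

Definition crit_route i j t (L : nat) := exists x s1 s2,
  [/\ G x, path e i s1 /\ last i s1 = x, path e x s2 /\ last x s2 = j,
      (size s1 + size s2 = t %[mod g])%N & (size s1 + size s2 = L)%N].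

(** The lengths need only be congruent: weights are measured by excess, and CSR entries absorb
    multiples of [g] at no cost. Such a route rules out that s witnesses a failure. *)
Definition crit_dominated i j s := exists x s1 s2,
  [/\ G x, path e i s1 /\ last i s1 = x, path e x s2 /\ last x s2 = j,
      (size s1 + size s2 = size s %[mod g])%N
    & wt w i s <= wt w i s1 + wt w x s2].

Section Fixed.
Variables (gcl cls : 'I_d -> nat).
Hypothesis gcl0 : (gcl x0 = 0 %[mod gamma])%N.
Hypothesis gclD : forall x s, path e x s ->
  (gcl (last x s) = gcl x + size s %[mod gamma])%N.
Hypothesis gcl_walk : forall x y N t, (0 < N)%N ->
  (gcl y = gcl x + t %[mod gamma])%N ->
  exists s, [/\ path e x s, last x s = y & (size s = t %[mod N])%N].
Hypothesis cls0 : (cls x0 = 0 %[mod g])%N.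
Hypothesis clsD : forall x s, G x -> path ec x s ->
  (cls (last x s) = cls x + size s %[mod g])%N.

Let clsS x y : G x -> ec x y -> (cls y = cls x + 1 %[mod g])%N.
Proof. by move=> Gx exy; apply: (clsD (s := [:: y]) Gx); rewrite /= exy. Qed.

Let gclS x y : e x y -> (gcl y = gcl x + 1 %[mod gamma])%N.
Proof. by move=> exy; apply: (gclD (s := [:: y])); rewrite /= exy. Qed.

Let GS x y : G x -> ec x y -> G y.
Proof. by move=> Gx exy; apply: connect_trans Gx (connect1 exy). Qed.

(** Both functions vanish at [x0] and grow by one along critical arcs, and [gamma] divides [g]. *)
Let cls_gcl x : G x -> (cls x = gcl x %[mod gamma])%N.
Proof.
case/connectP=> s ps ->.
have pe := sub_path ec_sub ps.
rewrite (gclD pe) -(modn_dvdm _ dvdn_mx_cyclicity) clsD ?connect0 //.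
rewrite modn_dvdm ?dvdn_mx_cyclicity // -modnDml -[in RHS]modnDml gcl0.
by rewrite -(modn_dvdm (cls x0) dvdn_mx_cyclicity) cls0 modn_dvdm ?dvdn_mx_cyclicity.
Qed.

Let cls_onto a : exists2 x, G x & (cls x = a %[mod gamma * h])%N.
Proof.
rewrite -gE.
have [s ps szs] := crit_walk_exists lambdaA a crit0.
exists (last x0 s); first exact: path_connect ps.
by rewrite clsD ?connect0 // -modnDml cls0 mod0n add0n szs.
Qed.

Lemma walk_through i j k t x y s : (gcl j = gcl i + t %[mod gamma])%N ->
  path e x s -> last x s = y -> size s = k ->
  exists s1 s2, [/\ path e i s1, last i s1 = x, path e y s2, last y s2 = j
    & (size s1 + k + size s2 = t %[mod g])%N].
Proof.
move=> ijt ps ls szs.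
have [s1 p1 l1] := walk_exists_connect (A_irr i x).
(* [t2] stands for t - n modulo [g], the length left for the final piece. *)
pose n := (size s1 + k)%N; pose t2 := (t + g.-1 * n)%N.
have gn : (t2 + n = t + g * n)%N by rewrite -addnA -mulSnr prednK.
have [|s2 [p2 l2 z2]] := gcl_walk (x := y) (y := j) (t := t2) g_gt0.
  have yE : (gcl y = gcl i + n %[mod gamma])%N.
    by rewrite -ls (gclD ps) -modnDml -l1 (gclD p1) modnDml szs addnA.
  rewrite ijt -[in RHS]modnDml yE modnDml -addnA [(n + _)%N]addnC gn addnA.
  by rewrite -[in RHS]modnDmr (eqP (dvdn_mulr n dvdn_mx_cyclicity)) addn0.
exists s1, s2; split=> //; rewrite -/n addnC -modnDml z2 modnDml gn.
by rewrite addnC mulnC modnMDl.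
Qed.

Section NodeRoute.
Variables (i j : 'I_d) (W : seq 'I_d).
Hypotheses (pW : path e i W) (lW : last i W = j).

Let ijW : (gcl j = gcl i + size W %[mod gamma])%N.
Proof. by rewrite -lW gclD. Qed.

Let touchN := touching e gamma h G i (pred1 i) (pred1 j) (size W).+1.

Let touch0 : exists s, touchN s.
Proof.
have [s1 [s2 [p1 l1 p2 l2]]] := walk_through (s := [::]) ijW isT (erefl x0) erefl.
rewrite addn0 => sz; exists (i :: (s1 ++ s2)); split=> //.
- by rewrite /= cat_path p1 l1.
- by rewrite /= eqxx last_cat l1 l2 eqxx.
- rewrite /= size_cat -gE -addn1 -[(size W).+1]addn1; apply/eqP.
  by rewrite eqn_modDr; apply/eqP.
apply/hasP; exists x0; last exact: connect0.
by rewrite -cat_cons mem_cat -l1 mem_last.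
Qed.

Lemma node_route : exists2 L, crit_route i j (size W) L &
  (L.+1 + g <= g * (d %/ gamma) + d)%N.
Proof.
have [s0 t0] := touch0.
have [s [s_gt0 ss IJ szs hG] le_s] :=
  short_touching mx_cyclicity_gt0 h_gt0 gclS cls_gcl cls_onto t0.
case: s => // a s in s_gt0 ss IJ szs hG le_s *.
case/andP: IJ => /eqP /= def_a /eqP ls; rewrite /= in def_a; subst a.
case/hasP: hG => x xs Gx.
case/splitPl: xs ss ls szs le_s => p1 p2 lp1 /= ss ls szs le_s.
rewrite card_ord -gE in le_s.
exists (size (p1 ++ p2)) => //; exists x, p1, p2; split=> //.
- by move: ss; rewrite cat_path => /andP[].
- by move: ss ls; rewrite cat_path last_cat lp1 => /andP[].
- apply/eqP; rewrite -(eqn_modDr 1) !addn1 -size_cat; apply/eqP.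
  by rewrite gE.
by rewrite size_cat.
Qed.

Lemma node_cyclicity_lt : (gamma <= (size W).+1)%N ->
  crit_dominated i j W \/ (h < d %/ gamma)%N.
Proof.
move=> szW; have [hG|nG] := boolP (has G (i :: W)); [left | right].
  case/hasP: hG => x xs Gx; move: pW lW; rewrite /crit_dominated.
  have [p1 [p2 [-> lp1]]] : exists p1 p2, W = p1 ++ p2 /\ last i p1 = x.
    by case/splitPl: xs => p1 p2 lp1; exists p1, p2.
  rewrite cat_path last_cat lp1 => /andP[pp1 pp2] lp2.
  by exists x, p1, p2; split=> //; rewrite ?size_cat // wt_cat lp1.
have := ltn_cyclicity_card i mx_cyclicity_gt0 h_gt0 gclS cls_gcl
  cls_onto (s := i :: W) pW szW nG.
by rewrite card_ord.
Qed.

End NodeRoute.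

Lemma node_cyclicity_le : (h <= d %/ gamma)%N.
Proof.
have := leq_cyclicity_card mx_cyclicity_gt0 h_gt0 cls_gcl cls_onto.
by rewrite card_ord.
Qed.

(** * Walks of labels in a factorisation A = U L *)

Section Labels.
Variables (r : nat) (U : 'M[Rmax R]_(d, r)) (L : 'M[Rmax R]_(r, d)).
Hypothesis defA : A = U *m L.
Implicit Types p q : 'I_r.

(** A live label occurs between a tail and a head, and the class of the head then fixes that of all
    its tails modulo [gamma]. *)
Let live p := [exists x, U x p != ninf] && [exists y, L p y != ninf].

Let el : rel 'I_r := fun p q =>
  [&& live p, live q & [exists y, (L p y != ninf) && (U y q != ninf)]].

Let UL_le x p y : rmax_le (U x p * L p y) (A x y).
Proof. by rewrite defA; apply: mulmx_ge; apply: rmax_le_refl. Qed.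

Let lbl x p y := U x p * L p y == A x y.

Let UL_arc x p y : U x p != ninf -> L p y != ninf -> e x y.
Proof.
have := UL_le x p y; rewrite /has_arc.
by case: (U x p) (L p y) (A x y) => [u|] [v|] [a|].
Qed.

Let lbl_fin x p y : e x y -> lbl x p y -> U x p != ninf /\ L p y != ninf.
Proof.
by rewrite /has_arc /lbl; case: (U x p) (L p y) (A x y) => [u|] [v|] [a|].
Qed.

Let lbl_exists x y : e x y -> exists p, lbl x p y.
Proof.
move=> /entryE Axy; have := Axy; rewrite {1}defA.
case/mulmx_attained=> p [u [v [Uxp Lpy uv]]].
by exists p; rewrite /lbl Uxp Lpy Axy uv.
Qed.

(** Exchanging the heads permutes the same four entries of U and L. These realise the two given arcs
    exactly and are lower bounds for the exchanged ones. *)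
Let lbl_swap x y x' y' p : e x y -> e x' y' -> lbl x p y -> lbl x' p y' ->
  [/\ e x y', e x' y & w x y + w x' y' <= w x y' + w x' y].
Proof.
move=> exy ex'y' lp lp'.
have [Uxp Lpy] := lbl_fin exy lp; have [Ux'p Lpy'] := lbl_fin ex'y' lp'.
have exy' := UL_arc Uxp Lpy'; have ex'y := UL_arc Ux'p Lpy.
split=> //; rewrite /excess.
have := UL_le x p y'; have := UL_le x' p y; move: lp lp'; rewrite /lbl.
rewrite (entryE exy) (entryE ex'y') (entryE exy') (entryE ex'y).
case: (U x p) (L p y) (U x' p) (L p y') Uxp Lpy Ux'p Lpy' => [u|] [v|] [u'|] [v'|] //.
move=> _ _ _ _ /eqP[<-] /eqP[<-] /= le1 le2; lra.
Qed.

(* So a label lies on critical arcs of one component only, and has a well-defined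
   class modulo g. *)
Let crit_swap x y x' y' p : ec x y -> ec x' y' -> lbl x p y -> lbl x' p y' ->
  ec x y'.
Proof.
move=> cxy cx'y' lp lp'.
have [exy [s [ps ls ws]]] := crit_arc_return lambdaA cxy.
have [ex'y' [s' [ps' ls' ws']]] := crit_arc_return lambdaA cx'y'.
have [exy' ex'y le] := lbl_swap exy ex'y' lp lp'.
(* The closed walk goes from x to y', returns critically to x', crosses to y and returns critically
   to x; by the exchange its excess is at least 0. *)
apply: (closed_walk_crit_arc lambdaA (s := s' ++ y :: s)) => //.
- by rewrite cat_path ls' /= ex'y (sub_path ec_sub ps) (sub_path ec_sub ps').
- by rewrite last_cat.
by rewrite wt_cat ls' /=; lra.
Qed.

Let GL p := [exists x, exists y, [&& G x, ec x y & lbl x p y]].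

Let GLP p : reflect (exists x y, [/\ G x, ec x y & lbl x p y]) (GL p).
Proof.
apply: (iffP existsP) => -[x]; first by case/existsP=> y /and3P[]; exists x, y.
by case=> y [Gx exy lp]; exists x; apply/existsP; exists y; apply/and3P.
Qed.

Let GL_live p : GL p -> live p.
Proof.
case/GLP=> x [y [_ /ec_sub exy /(lbl_fin exy)[Uxp Lpy]]].
by apply/andP; split; apply/existsP; [exists x | exists y].
Qed.

(** Read the class off at one chosen tail of p. Any other tail has an arc to the same head, critical
    when both given arcs are, so its class is the same. *)
Lemma label_classes : exists gclL clsL : 'I_r -> nat,
  [/\ forall x p, live p -> U x p != ninf -> (gclL p = gcl x %[mod gamma])%N
    & forall x p y, G x -> ec x y -> lbl x p y -> (clsL p = cls x %[mod g])%N].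
Proof.
have /choice[f fP] : forall p, exists x, live p -> U x p != ninf.
  move=> p; case: (boolP (live p)) => [|_]; last by exists x0.
  by case/andP=> /existsP[x Uxp] _; exists x.
have /choice[f' f'P] : forall p, exists x, GL p ->
    exists y, [/\ G x, ec x y & lbl x p y].
  move=> p; case: (GLP p) => [[x [y H]]|_]; last by exists x0.
  by exists x => _; exists y.
exists (gcl \o f), (cls \o f'); split=> [x p lp Uxp|x p y Gx cxy lp] /=.
  have := lp => /andP[_ /existsP[y Lpy]].
  have e1 := gclS (UL_arc Uxp Lpy); have e2 := gclS (UL_arc (fP _ lp) Lpy).
  by apply/eqP; rewrite -(eqn_modDr 1) -e1 -e2.
have [|y' [Gx' cx'y' lp']] := f'P p; first by apply/GLP; exists x, y.
have cxy' := crit_swap cxy cx'y' lp lp'.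
by apply/eqP; rewrite -(eqn_modDr 1) -(clsS Gx' cx'y') -(clsS Gx cxy').
Qed.

Let eG : rel 'I_r := fun p q =>
  [exists x, exists y, exists z,
    [&& G x, ec x y, ec y z, lbl x p y & lbl y q z]].

Let eGP p q : reflect (exists x y z,
    [/\ G x, ec x y, ec y z, lbl x p y & lbl y q z]) (eG p q).
Proof.
apply: (iffP existsP) => -[x].
  by case/existsP=> y /existsP[z /and5P[]]; exists x, y, z.
case=> y [z H]; exists x; apply/existsP; exists y; apply/existsP; exists z.
exact/and5P.
Qed.

Let eG_sub : subrel eG el.
Proof.
move=> p q /eGP[x [y [z [Gx cxy cyz lp lq]]]].
have Gy := GS Gx cxy.
have [_ Lpy] := lbl_fin (ec_sub cxy) lp; have [Uyq _] := lbl_fin (ec_sub cyz) lq.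
apply/and3P; split; last by apply/existsP; exists y; rewrite Lpy.
  by apply: GL_live; apply/GLP; exists x, y.
by apply: GL_live; apply/GLP; exists y, z.
Qed.

Let eG_crit p q : eG p q -> GL q.
Proof.
move=> /eGP[x [y [z [Gx cxy cyz lp lq]]]].
by apply/GLP; exists y, z; rewrite (GS Gx cxy).
Qed.

(** Follow a critical walk from the head of an arc labelled p to the tail of one labelled q,
    choosing a label for each arc on the way. *)
Let eG_connect p q : GL p -> GL q -> connect eG p q.
Proof.
case/GLP=> x [y [Gx cxy lp]] /GLP[x' [y' [Gx' cx'y' lq]]].
have Gy := GS Gx cxy.
have [s ps ls] := walk_exists_connect (connect_from_root ec_sym Gy Gx').
elim: s x y p Gx cxy lp Gy ps ls => [|z s IHs] x y p Gx cxy lp Gy /=.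
  move=> _ yx'; subst x'; apply: connect1; apply/eGP.
  by exists x, y, y'.
case/andP=> cyz ps ls; have [p' lp'] := lbl_exists (ec_sub cyz).
apply: connect_trans (IHs y z p' Gy cyz lp' (GS Gy cyz) ps ls).
by apply: connect1; apply/eGP; exists x, y, z.
Qed.

Let eG_succ p : GL p -> exists q, eG p q.
Proof.
case/GLP=> x [y [Gx cxy lp]]; have Gy := GS Gx cxy.
have [z cyz] := crit_node_arc lambdaA (G_crit Gy).
have [q lq] := lbl_exists (ec_sub cyz).
by exists q; apply/eGP; exists x, y, z.
Qed.

Lemma lab_exists : exists lab : 'I_d -> 'I_d -> 'I_r,
  forall x y, e x y -> lbl x (lab x y) y.
Proof.
have [y0 c0] := crit_node_arc lambdaA crit0.
have [p0 lp0] := lbl_exists (ec_sub c0).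
have /choice[f fP] : forall xy : 'I_d * 'I_d, exists p, e xy.1 xy.2 -> lbl xy.1 p xy.2.
  move=> xy; case: (boolP (e xy.1 xy.2)) => [/lbl_exists[p lp]|_].
    by exists p.
  by exists p0.
by exists (fun x y => f (x, y)) => x y; apply: (fP (x, y)).
Qed.

(** Consecutive labels share a node, so n labels unfold to a walk of n arcs. *)
Let lift_walk x y p s : U x p != ninf -> path el p s -> L (last p s) y != ninf ->
  exists s', [/\ path e x s', last x s' = y & size s' = (size s).+1].
Proof.
elim: s x p => [|q s IHs] x p Uxp /=.
  by move=> _ Lpy; exists [:: y]; rewrite /= (UL_arc Uxp Lpy).
case/andP=> /and3P[_ _ /existsP[z /andP[Lpz Uzq]]] ps lz.
have [s' [ps' ls' zs']] := IHs _ _ Uzq ps lz.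
by exists (z :: s'); rewrite /= (UL_arc Uxp Lpz) ps' ls' zs'.
Qed.

Section LabelRoute.
Variables (i j : 'I_d) (W : seq 'I_d).
Hypotheses (pW : path e i W) (lW : last i W = j).
Variable gclL clsL : 'I_r -> nat.
Hypothesis gclLE : forall x p, live p -> U x p != ninf ->
  (gclL p = gcl x %[mod gamma])%N.
Hypothesis clsLE : forall x p y, G x -> ec x y -> lbl x p y ->
  (clsL p = cls x %[mod g])%N.

Let gclLS p q : el p q -> (gclL q = gclL p + 1 %[mod gamma])%N.
Proof.
case/and3P=> lp lq /existsP[y /andP[Lpy Uyq]].
have /andP[/existsP[x Uxp] _] := lp.
rewrite (gclLE lq Uyq) (gclS (UL_arc Uxp Lpy)) -modnDml -(gclLE lp Uxp).
by rewrite modnDml.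
Qed.

Let clsL_gcl p : GL p -> (clsL p = gclL p %[mod gamma])%N.
Proof.
move=> Gp; have lp := GL_live Gp; case/GLP: Gp => x [y [Gx cxy lxy]].
have [Uxp _] := lbl_fin (ec_sub cxy) lxy.
rewrite (gclLE lp Uxp) -cls_gcl // -(modn_dvdm _ dvdn_mx_cyclicity).
by rewrite (clsLE Gx cxy lxy) modn_dvdm ?dvdn_mx_cyclicity.
Qed.

Let clsL_onto a : exists2 p, GL p & (clsL p = a %[mod gamma * h])%N.
Proof.
have [x Gx ca] := cls_onto a; have [y cxy] := crit_node_arc lambdaA (G_crit Gx).
have [p lp] := lbl_exists (ec_sub cxy); exists p; first by apply/GLP; exists x, y.
by rewrite -ca -gE; apply: clsLE lp.
Qed.

Let eG_cls p q : eG p q -> (clsL q = clsL p + 1 %[mod gamma * h])%N.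
Proof.
case/eGP=> x [y [z [Gx cxy cyz lp lq]]]; rewrite -gE.
rewrite (clsLE (GS Gx cxy) cyz lq) (clsS Gx cxy) -modnDml -(clsLE Gx cxy lp).
by rewrite modnDml.
Qed.

Lemma label_cyclicity_le : (h <= r %/ gamma)%N.
Proof.
have := leq_cyclicity_card mx_cyclicity_gt0 h_gt0 clsL_gcl clsL_onto.
by rewrite card_ord.
Qed.

Variable lab : 'I_d -> 'I_d -> 'I_r.
Hypothesis labP : forall x y, e x y -> lbl x (lab x y) y.

Let lab_live x y : e x y -> live (lab x y).
Proof.
move=> exy; have [Uxp Lpy] := lbl_fin exy (labP exy).
by apply/andP; split; apply/existsP; [exists x | exists y].
Qed.

Let lab_path x y s : path e x (y :: s) -> path el (lab x y) (pairmap lab y s).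
Proof.
elim: s x y => //= z s IHs x y /and3P[exy eyz ps].
rewrite IHs /= ?eyz // andbT /el !lab_live //=; apply/existsP; exists y.
have [_ ->] := lbl_fin exy (labP exy).
by have [->] := lbl_fin eyz (labP eyz).
Qed.

Let lab_last x y s : path e x (y :: s) ->
  L (last (lab x y) (pairmap lab y s)) (last y s) != ninf.
Proof.
elim: s x y => [|z s IHs] x y /= /andP[exy ps]; last exact: IHs.
by have [] := lbl_fin exy (labP exy).
Qed.

Let lab_sorted s : path e i s -> sorted el (pairmap lab i s).
Proof. by case: s => // y s; apply: lab_path. Qed.

(** If an arc x' -> y' of the walk shares its label with a critical arc x -> y, reroute it as x' ->
    y, critically back to x, then x -> y'. The exchange loses no excess, and the added length is
    that of a closed critical walk. *)
Lemma label_cyclicity_lt : (gamma <= size W)%N ->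
  crit_dominated i j W \/ (h < r %/ gamma)%N.
Proof.
move=> szW; have [hG|nG] := boolP (has GL (pairmap lab i W)); last first.
  right; have := ltn_cyclicity_card (lab x0 x0) mx_cyclicity_gt0 h_gt0 gclLS
    clsL_gcl clsL_onto (lab_sorted pW).
  by rewrite size_pairmap card_ord; apply.
left; case/hasP: hG => p /mem_pairmap[s1 [y' [s2 [defW defp]]]].
case/GLP=> x [y [Gx cxy lp]]; move: pW lW; rewrite defW.
set x' := last i s1 in defp; rewrite cat_path last_cat /= -/x'.
case/and3P=> p1 ex'y' p2 l2; have lp' := labP ex'y'; rewrite -defp in lp'.
have [exy [c [pc lc wc]]] := crit_arc_return lambdaA cxy.
have [exy' ex'y le] := lbl_swap exy ex'y' lp lp'.
exists y, (s1 ++ [:: y]), (c ++ y' :: s2); split.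
- exact: GS Gx cxy.
- by rewrite cat_path last_cat /= -/x' ex'y p1.
- by rewrite cat_path last_cat /= lc exy' p2 (sub_path ec_sub pc).
- have dc : (g %| size c + 1)%N.
    have := dvdn_closed_walk ec_sym Gx (s := y :: c).
    by rewrite addn1; apply; rewrite //= cxy.
  rewrite !size_cat /=; have -> : (size s1 + 1 + (size c + (size s2).+1) =
    size s1 + (size s2).+1 + (size c + 1))%N.
    by rewrite [(size c + (size s2).+1)%N]addnC addnACA [(1 + _)%N]addnC.
  by rewrite -modnDmr (eqP dc) addn0.
by rewrite !wt_cat /= lc -/x'; lra.
Qed.

Let I p := live p && (U i p != ninf).
Let J p := L p j != ninf.

Let touchL := touching el gamma h GL (lab x0 x0) I J (size W).

Let touchL0 : exists s, touchL s.
Proof.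
have [y c0] := crit_node_arc lambdaA crit0.
have ijW : (gcl j = gcl i + size W %[mod gamma])%N by rewrite -lW gclD.
have [|s1 [s2 [p1 l1 p2 l2 sz]]] :=
    walk_through (k := 1) (x := x0) (y := y) (s := [:: y]) ijW _ erefl erefl.
  by rewrite /= ec_sub.
have ps : path e i (s1 ++ y :: s2) by rewrite cat_path p1 l1 /= ec_sub.
have ls : last i (s1 ++ y :: s2) = j by rewrite last_cat.
exists (pairmap lab i (s1 ++ y :: s2)); split.
- by rewrite size_pairmap size_cat addnS.
- exact: lab_sorted.
- move: ps ls; case: (s1) => [|z s1'] /=.
    move=> ps ls; rewrite /I /J -ls (lab_last ps); case/andP: ps => ey _.
    by rewrite lab_live //; have [->] := lbl_fin ey (labP ey).
  move=> ps ls; rewrite /I /J -ls (lab_last ps); case/andP: ps => ez _.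
  by rewrite lab_live //; have [->] := lbl_fin ez (labP ez).
- by rewrite size_pairmap size_cat -gE -sz /= -addSnnS addn1.
apply/hasP; exists (lab x0 y).
  by rewrite pairmap_cat l1 mem_cat mem_head orbT.
apply/GLP; exists x0, y; split=> //.
by apply: labP; apply: ec_sub.
Qed.

Lemma label_route : exists2 n, crit_route i j (size W) n &
  (n + g <= g * (r %/ gamma) + r + gamma)%N.
Proof.
have [s0 t0] := touchL0.
have [s1 [p [q [s2 [[_ ss IJ szs _] eGpq le_s]]]]] :=
  short_marked mx_cyclicity_gt0 h_gt0 gclLS clsL_gcl clsL_onto eG_sub eG_crit
    eG_cls eG_connect eG_succ t0.
rewrite card_ord -gE in le_s.
case/eGP: eGpq => x [y [z [Gx cxy cyz lp lq]]].
have [_ Lpy] := lbl_fin (ec_sub cxy) lp; have [Uyq _] := lbl_fin (ec_sub cyz) lq.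
case/andP: IJ => /andP[_ Ui]; rewrite /J last_cat /= => Lj.
move: ss; rewrite sorted_cat_cons => /andP[ss1 /andP[_ ps2]].
(* The walk of labels is split at the critical node y between p and q, and both halves are lifted;
   the number of arcs equals the number of labels. *)
have [t1 [pt1 lt1 zt1]] : exists s', [/\ path e i s', last i s' = y
    & size s' = (size s1).+1].
  case: s1 ss1 Ui {szs le_s Lj} => [|p1 s1] /= ss1 Ui.
    exact: (lift_walk (s := [::]) Ui isT Lpy).
  by rewrite -(size_rcons s1 p); apply: (lift_walk Ui ss1); rewrite last_rcons.
have [t2 [pt2 lt2 zt2]] := lift_walk Uyq ps2 Lj.
exists (size t1 + size t2)%N.
  exists y, t1, t2; split=> //; first exact: GS Gx cxy.
  by rewrite zt1 zt2 gE -szs size_cat /= addSnnS.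
by rewrite zt1 zt2 addSnnS; move: le_s; rewrite size_cat.
Qed.

End LabelRoute.
End Labels.
End Fixed.

(** Common outcome of the two counts, used with (d, d - 1) for nodes and with (r, r + [gamma]) for
    labels. *)
Definition route_bound N D := (h <= N %/ gamma)%N /\
  forall i j s, path e i s -> last i s = j ->
    (exists2 n, crit_route i j (size s) n & (n + g <= g * (N %/ gamma) + D)%N) /\
    ((D <= size s)%N -> crit_dominated i j s \/ (h < N %/ gamma)%N).

Let classes : exists gcl cls : 'I_d -> nat,
  [/\ (gcl x0 = 0 %[mod gamma])%N /\
      forall x s, path e x s ->
        (gcl (last x s) = gcl x + size s %[mod gamma])%N,
      forall x y N t, (0 < N)%N -> (gcl y = gcl x + t %[mod gamma])%N ->
        exists s, [/\ path e x s, last x s = y & (size s = t %[mod N])%N],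
      (cls x0 = 0 %[mod g])%N
    & forall x s, G x -> path ec x s ->
        (cls (last x s) = cls x + size s %[mod g])%N].
Proof.
have := mx_cyclicity_gt0; rewrite (mx_cyclicityE A_irr x0) => gamma0.
have [gcl [gcl0 gclD gcl_walk]] := cyclic_classes A_sym gamma0.
have [cls [cls0 clsD _]] := cyclic_classes ec_sym g_gt0.
exists gcl, cls; split=> //; first by split=> // x s; apply: gclD.
by move=> x y N t N0; apply: gcl_walk.
Qed.

Lemma route_bound_nodes : route_bound d d.-1.
Proof.
have [gcl [cls [[gcl0 gclD] gcl_walk cls0 clsD]]] := classes.
have d_gt0 : (0 < d)%N by apply: leq_trans (ltn_ord x0).
split=> [|i j s ps ls]; first exact: node_cyclicity_le gcl0 gclD cls0 clsD.
split.
  have [n nr le_n] := node_route gcl0 gclD gcl_walk cls0 clsD ps ls.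
  by exists n => //; move: le_n d_gt0; clear; lia.
move=> szs; apply: (node_cyclicity_lt gcl0 gclD cls0 clsD ps ls).
have le_h := node_cyclicity_le gcl0 gclD cls0 clsD.
have : (gamma <= d)%N.
  by rewrite -divn_gt0 ?mx_cyclicity_gt0 //; apply: leq_trans le_h.
by move: szs; clear; lia.
Qed.

Lemma route_bound_factors r : factors_through A r -> route_bound r (r + gamma).
Proof.
case=> U [L defA]; have [gcl [cls [[gcl0 gclD] gcl_walk cls0 clsD]]] := classes.
have [gclL [clsL [gclLE clsLE]]] := label_classes gclD clsD defA.
have [lab labP] := lab_exists defA.
split=> [|i j s ps ls].
  have := label_cyclicity_le gcl0 gclD cls0 clsD defA; apply; [exact: gclLE | exact: clsLE].
split.
  have [n nr le_n] := label_route gcl0 gclD gcl_walk cls0 clsD defA ps ls gclLE clsLE labP.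
  by exists n => //; rewrite addnA.
move=> szs; apply: (label_cyclicity_lt gcl0 gclD cls0 clsD defA ps ls gclLE clsLE labP).
by apply: leq_trans szs; apply: leq_addl.
Qed.

End Routes.

(** * The transient *)

Section Subordinate.
Variables (R : realType) (d : nat) (A B : 'M[Rmax R]_d).
Hypothesis B_sub : subordinate B A.

Lemma subordinate_arc i j : has_arc B i j -> has_arc A i j /\ entry B i j = entry A i j.
Proof. by rewrite /has_arc /entry; case: (B_sub i j) => -> //; rewrite eqxx. Qed.

Lemma subordinate_walk i s : path (has_arc B) i s ->
  path (has_arc A) i s /\ wt (entry B) i s = wt (entry A) i s.
Proof.
elim: s i => //= j s IHs i /andP[/subordinate_arc[-> ->] /IHs[-> ->]].
by [].
Qed.

Lemma subordinate_lambda m : lambda B = Some m ->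
  exists2 l, lambda A = Some l & m <= l.
Proof.
case/lambda_attained=> c; rewrite mem_filter => /andP[_ cB] sum_c.
have c0 := simple_cycle_neq0 cB.
have cA : c \in simple_cycles (has_arc A).
  move: cB; rewrite !mem_filter => /andP[cc ->]; rewrite andbT.
  by apply: sub_cycle cc => i j /subordinate_arc[].
have sum_eq : \sum_(z <- c) entry A z (next c z) = (size c)%:R * m.
  rewrite -sum_c big_seq [RHS]big_seq; apply: eq_bigr => z zc.
  have ce : cycle (has_arc B) c by move: cB; rewrite mem_filter => /andP[].
  by have [] := subordinate_arc (next_cycle ce zc).
have := @rmax_le_sum _ _ _ predT (cycle_mean A) _ cA isT.
rewrite -/(lambda A) cycle_meanE // sum_eq [_%:R * m]mulrC mulfK ?gt_eqF //.
by case: (lambda A) => [l|] //= ml; exists l.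
Qed.

End Subordinate.

Section Transient.
Variables (R : realType) (d : nat) (A B : 'M[Rmax R]_d) (l m : R) (x0 : 'I_d).
Hypotheses (A_irr : irreducible A) (B_sub : subordinate B A).
Hypotheses (lambdaA : lambda A = Some l) (lambdaB : lambda B = Some m).
Hypotheses (ml : m < l) (crit0 : crit_node A x0).
Notation gamma := (mx_cyclicity A).
Notation g := (scc_cyclicity (crit_arc A) x0).
Notation sigma := (max_crit_cyclicity A).
Notation mn := (min_fin_entry A).
Notation mx := (fin_part (max_entry B)).
Notation cd := (longest_path (has_arc B)).
Notation CSR t := (csr_C A *m csr_S A ^+ t *m csr_R A).

Let mn_le_m : mn <= m.
Proof.
apply: (le_lambda lambdaB) => i j /(subordinate_arc B_sub)[Aij ->].
exact: min_le_entry.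
Qed.

Let m_le_mx : m <= mx.
Proof. exact: lambda_le_max. Qed.

Let T2_boundE K :
  T2_bound A B K = (K * (l - mn) + cd%:R * (mx - m)) / (l - m).
Proof. by rewrite /T2_bound lambdaA lambdaB. Qed.

(** The quotient of l - mn by l - m is at least 1, as [lambda B] is a mean of entries of A. This
    settles times not exceeding K. *)
Lemma le_T2_bound K : 0 <= K -> K <= T2_bound A B K.
Proof.
move=> K0; rewrite T2_boundE ler_pdivlMr ?subr_gt0 //.
rewrite -[leLHS]addr0 lerD //.
  by apply: ler_wpM2l; rewrite // lerD2l lerN2.
by rewrite mulr_ge0 ?subr_ge0 ?ler0n.
Qed.

Definition fails_at t i j :=
  ~~ rmax_le ((B ^+ t) i j) ((lambda A ^+ t *: CSR t) i j).

(** A failure makes every route through the component lighter than the walk of B. Comparing the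
    least possible weight of a route with the largest possible weight of that walk gives the
    displayed inequality. *)
Lemma fails_walk t i j : fails_at t i j -> exists s,
  [/\ path (has_arc A) i s /\ last i s = j, size s = t,
      forall n, crit_route A x0 i j t n ->
        n%:R * (mn - l) < t%:R * (m - l) + cd%:R * (mx - m)
    & ~ crit_dominated A l x0 i j s].
Proof.
rewrite /fails_at; case def_v: ((B ^+ t) i j) => [v|] // fail.
have [s [psB ls szs ws]] := expmx_attained def_v.
have [psA wAB] := subordinate_walk B_sub psB.
have le_v := walk_weight_le lambdaB psB; rewrite ws szs in le_v.
have too_small x s1 s2 : connect (crit_arc A) x0 x ->
    path (has_arc A) i s1 /\ last i s1 = x ->
    path (has_arc A) x s2 /\ last x s2 = j ->
    (size s1 + size s2 = t %[mod g])%N ->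
    wt (excess A l) i s1 + wt (excess A l) x s2 < v - t%:R * l.
  move=> Gx [p1 l1] [p2 l2] sz.
  have := csr_ge lambdaA crit0 Gx p1 l1 p2 l2 sz; move: fail.
  rewrite lambdaA rmax_expr mxE; case: ((CSR t) i j) => [c|] //= nle le_c.
  by move: nle; rewrite -ltNge; lra.
exists s; split=> //.
  move=> n [x [s1 [s2 [Gx [p1 l1] [p2 l2] sz <-]]]].
  have lt := too_small _ _ _ Gx (conj p1 l1) (conj p2 l2) sz.
  have ge u s' : path (has_arc A) u s' ->
      (size s')%:R * (mn - l) <= wt (excess A l) u s'.
    apply: wt_ge => a b /min_le_entry le; exact: lerB.
  have := ge _ _ p1; have := ge _ _ p2; rewrite natrD mulrDl; lra.
case=> x [s1 [s2 [Gx H1 H2]]]; rewrite szs => sz le.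
have := too_small _ _ _ Gx H1 H2 sz; move: le; rewrite wt_excess -wAB ws szs.
lra.
Qed.

(** The last failure precedes T2 by one, so an integral gain is wanted: the Wielandt bound has room
    for t + 1, the bound in sigma only yields a strict inequality for t. *)
Lemma fails_bound N D t i j : route_bound A l x0 N D -> fails_at t i j ->
  t%:R < T2_bound A B (sigma%:R * ((N %/ gamma)%:R - 1) + D%:R) /\
  t.+1%:R <= T2_bound A B ((gamma * Wi (N %/ gamma))%:R + D%:R).
Proof.
move=> [le_h routes] /fails_walk[s [[ps ls] szs gap not_dom]].
have [[n nr le_n] dom_or_lt] := routes _ _ _ ps ls; rewrite szs in nr dom_or_lt.
have lt_t := gap _ nr.
have gamma0 : (0 < gamma)%N := mx_cyclicity_gt0 A_irr lambdaA crit0.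
have gE := divnK (dvdn_mx_cyclicity A_irr lambdaA crit0).
set h := (g %/ gamma)%N in le_h dom_or_lt gE; set q := (N %/ gamma)%N in le_h dom_or_lt le_n *.
have g0 : (0 < g)%N := scc_crit_gt0 lambdaA crit0.
have h0 : (0 < h)%N by move: g0; rewrite -gE muln_gt0 => /andP[].
have g_sigma : (g <= sigma)%N by apply: leq_bigmax_cond.
rewrite !T2_boundE ltr_pdivlMr ?ler_pdivlMr ?subr_gt0 //; split.
  have le_K : n%:R <= sigma%:R * (q%:R - 1) + D%:R :> R.
    have : (n <= sigma * q.-1 + D)%N by nia.
    rewrite -(ler_nat R) natrD natrM -subn1 natrB //.
    exact: leq_trans le_h.
  have := ler_wpM2r (_ : 0 <= l - mn) le_K; rewrite subr_ge0 => /(_ (ltW (le_lt_trans mn_le_m ml))).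
  by move: (_ * _ + D%:R) => K; nra.
have [lt|ge] := leqP t.+1 (gamma * Wi q + D)%N.
  rewrite -ler_pdivlMr ?subr_gt0 // -T2_boundE -natrD.
  by apply: le_trans (le_T2_bound (ler0n _ _)); rewrite ler_nat.
have /dom_or_lt[//|lt_h] : (D <= t)%N.
  by apply: leq_trans (ge : (_ <= t)%N); apply: leq_addl.
(* From n + g <= g q + D and h < q one gets n <= gamma (q - 1)^2 + D; the summand 1 in [Wi]
   contributes a further [gamma], enough for n + 1. The additional l - mn then covers the l - m
   needed to pass from t to t + 1. *)
have le_K : n.+1%:R <= (gamma * Wi q)%:R + D%:R :> R.
  rewrite -natrD ler_nat /Wi ifT; last exact: leq_ltn_trans lt_h.
  case: q lt_h {le_h dom_or_lt ge} le_n => // q; rewrite ltnS subn1 /= => hq.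
  rewrite -gE => le_n; have : (h * gamma * q <= gamma * q ^ 2)%N.
    by rewrite mulnAC mulnC leq_mul2l -mulnn leq_mul2r hq !orbT.
  by move: le_n gamma0; rewrite mulnS mulnDr muln1; clear; lia.
have lm : l - m <= l - mn by rewrite lerD2l lerN2.
have := ler_wpM2r (_ : 0 <= l - mn) le_K.
rewrite subr_ge0 (le_trans mn_le_m (ltW ml)) => /(_ isT).
rewrite -!natr1; move: lt_t lm; move: (_ + D%:R) => K; nra.
Qed.

(** Failure times are bounded, so a least threshold exists; if positive, it directly follows a
    failure. *)
Lemma T2_exists : exists2 T, is_T2 A B T &
  T = 0%N \/ exists t i j, T = t.+1 /\ fails_at t i j.
Proof.
pose X := T2_bound A B (sigma%:R * ((d %/ gamma)%:R - 1) + d.-1%:R).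
have fails_lt t i j : fails_at t i j -> t%:R < X.
  move=> fail; have rb := route_bound_nodes A_irr lambdaA crit0.
  by have [] := fails_bound rb fail.
have ex : exists T, `[< csr_dominates_from A B T >].
  exists (Num.bound `|X|); apply/asboolP => t leTt i j.
  apply: contraT => /fails_lt; rewrite ltNge => /negP[].
  apply: le_trans (ler_norm X) _; apply: le_trans (ltW (archi_boundP (normr_ge0 X))) _.
  by rewrite ler_nat.
case: (ex_minnP ex) => T /asboolP domT minT; exists T.
  by split=> // T' domT'; apply/minT/asboolP.
case: T domT minT => [|t] domT minT; [by left | right].
have [[i [j fail]]|nofail] := pselect (exists i j, fails_at t i j).
  by exists t, i, j.
suff /asboolP/minT : csr_dominates_from A B t by rewrite ltnn.
move=> t'; rewrite leq_eqVlt => /predU1P[<- i j|]; last exact: domT.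
by apply: contraT => fail; case: nofail; exists i, j.
Qed.

Lemma T2_bounds N D T : route_bound A l x0 N D ->
  T = 0%N \/ (exists t i j, T = t.+1 /\ fails_at t i j) ->
  T%:R <= T2_bound A B ((gamma * Wi (N %/ gamma))%:R + D%:R) /\
  T%:Z <= Num.ceil (T2_bound A B (sigma%:R * ((N %/ gamma)%:R - 1) + D%:R)).
Proof.
move=> rb [->|[t [i [j [-> fail]]]]]; last first.
  have [lt le] := fails_bound rb fail; split=> //.
  by rewrite intS addrC lezD1 ceil_gt_int.
(* With T = 0 only nonnegativity is at stake, and q >= h >= 1 makes q - 1 nonnegative. *)
have q_gt0 : (0 < N %/ gamma)%N.
  apply: leq_trans rb.1; rewrite divn_gt0 ?(mx_cyclicity_gt0 A_irr lambdaA crit0) //.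
  apply: dvdn_leq (dvdn_mx_cyclicity A_irr lambdaA crit0).
  exact: scc_crit_gt0 lambdaA _ crit0.
have T2_bound_ge0 K : 0 <= K -> 0 <= T2_bound A B K.
  by move=> K0; apply: le_trans (le_T2_bound K0).
split; first by rewrite T2_bound_ge0 // addr_ge0 ?ler0n.
rewrite ceil_ge0; apply: lt_le_trans (_ : 0 <= _); first by rewrite ltrN10.
by rewrite T2_bound_ge0 // addr_ge0 ?mulr_ge0 ?ler0n // subr_ge0 ler1n.
Qed.

End Transient.

(* "T2 <= x" for the second and fourth (real) bounds x is read as
   T2 <= ceil x, i.e. the inequality defining T2 holds for all integers t >= x:
   the integer T2 may exceed a non-integral x.  For instance, with the rows
   (0, -5), (-5, -4) for A and (-oo, -5), (-5, -4) for B, T2 = 3 and the second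
   bound is 5/2; with (0, -oo, -10), (-10, -9, -9), (-oo, -10, -10) for A, of
   factor rank 2, and B obtained by deleting the 0, T2 = 5 and the fourth bound
   is 40/9. *)
Theorem theorem6p3 (R : realType) (d : nat) (A B : 'M[Rmax R]_d) (r : nat)
    (A_irr : irreducible A) (A_rank : is_factor_rank A r)
    (B_sub : subordinate B A) (lambdaB_fin : lambda B != ninf)
    (lambda_neq : lambda A != lambda B) :
  let gamma := mx_cyclicity A in
  let sigma := max_crit_cyclicity A in
  exists T2 : nat,
    is_T2 A B T2 /\
    [/\ T2%:R <= T2_bound A B ((gamma * Wi (d %/ gamma))%:R + d%:R - 1),
        T2%:Z <= Num.ceil (T2_bound A B
                   (sigma%:R * ((d %/ gamma)%:R - 1) + d%:R - 1)),
        T2%:R <= T2_bound A B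
                   ((gamma * Wi (r %/ gamma))%:R + r%:R + gamma%:R)
      & T2%:Z <= Num.ceil (T2_bound A B
                   (sigma%:R * ((r %/ gamma)%:R - 1) + r%:R + gamma%:R))].
Proof.
move=> gamma sigma.
case lambdaB: (lambda B) lambdaB_fin lambda_neq => [m|] // _ lambda_neq.
have [l lambdaA le_ml] := subordinate_lambda B_sub lambdaB.
(* Subordination gives m <= l and equality is excluded, so the denominator is positive. *)
have ml : m < l.
  rewrite lt_neqAle le_ml andbT; apply: contraNneq lambda_neq => ->.
  by rewrite lambdaA.
have [c cc _] := lambda_attained lambdaA.
have [x0 crit0] : exists x0, crit_node A x0.
  have : c \in simple_cycles (has_arc A).
    by move: cc; rewrite mem_filter => /andP[].
  rewrite mem_filter mem_uniq_seqs; case: c cc => [|x0 c] cc; first by rewrite andbF.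
  by move=> _; exists x0; apply/hasP; exists (x0 :: c); rewrite ?mem_head.
have rb_nodes := route_bound_nodes A_irr lambdaA crit0.
have rb_factors := route_bound_factors A_irr lambdaA crit0 A_rank.1.
have [T2 T2P fail] := T2_exists A_irr B_sub lambdaA lambdaB ml crit0.
have d1 : d.-1%:R = d%:R - 1 :> R.
  by rewrite -subn1 natrB // (leq_trans _ (ltn_ord x0)).
exists T2; split=> //.
have [b1 b2] := T2_bounds A_irr B_sub lambdaA lambdaB ml crit0 rb_nodes fail.
have [b3 b4] := T2_bounds A_irr B_sub lambdaA lambdaB ml crit0 rb_factors fail.
split.
- by rewrite -addrA -d1.
- by rewrite -addrA -d1.
- by rewrite -addrA -natrD.
by rewrite -addrA -natrD.
Qed.
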